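(* Let $A$ be an indecomposable bialgebra with triangular decomposition of separable non-degenerate type over a group $G$. Then $A$ is an asymmetric braided Drinfeld double over $kG$.
   Context: Let $k$ be a field, $G$ a group, $H=kG$. **Braided doubles.** Let $V$ be a finite-dimensional left $H$-module and $V^*$ its dual with pairing $\langle\ ,\ \rangle:V^*\otimes V\to k$ and right action $\langle f\triangleleft h,v\rangle=\langle f,h\triangleright v\rangle$. For linear $\beta:V^*\otimes V\to H$, $A_\beta(V,V^* )$ is the algebra generated by $V,H,V^*$ with relations $fh=h_{(1)}(f\triangleleft h_{(2)})$, $hv=(h_{(1)}\triangleright v)h_{(2)}$, $[f,v]=\beta(f\otimes v)$; it is a free braided double if multiplication $T(V)\otimes H\otimes T(V^* )\to A_\beta(V,V^* )$ is a linear isomorphism. A triangular ideal is $J=I\otimes H\otimes T(V^* )+T(V)\otimes H\otimes I^*$ with $I\triangleleft T^{>1}(V)$, $I^*\triangleleft T^{>1}(V^* )$ homogeneously generated, $H$-invariant ideals with $T(V^* )I\subseteq J$ and $I^*T(V)\subseteq J$. The quotient by $J$ is a braided double, isomorphic to $T(V)/I\otimes H\otimes T(V^* )/I^*$ as a vector space. Natural grading: $\deg v=1$, $\deg h=0$, $\deg f=-1$. **Triangular decomposition.** A bialgebra with triangular decomposition over $H$ is a braided double with a bialgebra structure such that $H$ is a subcoalgebra with its original coproduct, the subspaces generated by $V,H$ and by $H,V^*$ are closed under the coproduct, and coproduct and counit are graded algebra morphisms. Moreover $\Delta(V)\subseteq V\otimes H+H\otimes V$, $\Delta(V^* )\subseteq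 V^*\otimes H+H\otimes V^*$; this gives right and left $G$-gradings on $V$ and $V^*$. A triangular Hopf ideal is a triangular ideal which is also a coideal (with $I$, $I^*$ Yetter--Drinfeld submodules for all these gradings). Every bialgebra with triangular decomposition is regarded as the quotient of a free one by a triangular Hopf ideal. **Indecomposable, separable, non-degenerate.** $A$ is indecomposable if the graph with vertices the grouplikes of $A$, and an edge $h\to g$ whenever there is $x\notin kG(A)$ with $\Delta(x)=x\otimes g+h\otimes x$, is connected. Weakly separable type: the right degrees of a homogeneous basis of $V$ are pairwise distinct, and likewise the left degrees of $V$, and the right and the left degrees of $V^*$. An indecomposable $A$ of weakly separable type is written in the following form (after rescaling the generators by group elements): $A$ is a quotient by a triangular Hopf ideal of a free braided double $T(V)\otimes kG\otimes T(V^* )$ where $G$ is generated by $k_1,\dots,k_n,l_1,\dots,l_n$ with $k_il_j=l_jk_i$; $V$, $V^*$ have bases $v_i$, $f_i$ with $\Delta(v_i)=v_i\otimes k_i+1\otimes v_i$, $\Delta(f_i)=f_i\otimes1+l_i\otimes f_i$; $g\triangleright v_i=\lambda_i(g)v_i$, $f_i\triangleleft g=\lambda_i(g)f_i$ for characters $\lambda_i$ of $G$ with $\lambda_j(k_i)=\lambda_i(l_j)^{-1}$; and $[f_i,v_j]=\gamma_{ij}(k_j-l_i)$ with $\gamma_{ij}\in k$, $\gamma_{ij}=0$ if $\lambda_i\ne\lambda_j$ (in which case also $\langle f_i,v_j\rangle=0$). It is of separable type if moreover $\lambda_1,\dots,\lambda_n$ are pairwise distinct, and non-degenerate if $\gamma_{ii}\neq0$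 for all $i$ (which entails $k_i\ne l_i$). In the separable case $G$ is abelian. **Asymmetric braided Drinfeld doubles** (primitively generated, over $H=kG$). Let $V$, $V^*$ be finite-dimensional left Yetter--Drinfeld modules over $H$, with left coactions $v\mapsto v^{(-1)}\otimes v^{(0)}$, $f\mapsto f^{(-1)}\otimes f^{(0)}$, such that the action on $V^*$ is dual to that on $V$ with respect to a perfect pairing $\langle\ ,\ \rangle:V^*\otimes V\to k$ (the coactions need not be dual to each other), and such that in $V\otimes V^*$ $$(f^{(-1)}\triangleright v)\otimes f^{(0)}=v^{(0)}\otimes(v^{(-1)}\triangleright f)\qquad (v\in V,\ f\in V^* ).$$ The asymmetric braided Drinfeld double of the tensor algebras $T(V)$, $T(V^* )$ is the Hopf algebra on $T(V)\otimes H\otimes T(V^* )$ with the relations $fh=h_{(1)}(f\triangleleft h_{(2)})$ (with $\triangleleft$ the right action on $V^*$ dual to $\triangleright$ on $V$), $hv=(h_{(1)}\triangleright v)h_{(2)}$ and $$[f,v]=S^{-1}(v^{(-1)})\langle f,v^{(0)}\rangle-f^{(-1)}\langle f^{(0)},v\rangle,$$ with coproduct extending that of $H$, $\Delta(v)=v^{(0)}\otimes S^{-1}(v^{(-1)})+1\otimes v$, $\Delta(f)=f\otimes1+f^{(-1)}\otimes f^{(0)}$, counit $\varepsilon(v)=\varepsilon(f)=0$ and antipode $S(v)=-v^{(0)}v^{(-1)}$, $S(f)=-S(f^{(-1)})f^{(0)}$. Quotients of it by triangular Hopf ideals are the asymmetric braided Drinfeld doubles of the corresponding quotients of $T(V)$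 and $T(V^* )$. ''$A$ is an asymmetric braided Drinfeld double over $kG$'' means that $A$ is isomorphic as a Hopf algebra to such a (quotient) double. *)

(* Defs.v *)
From HB Require Import structures.
From mathcomp Require Import all_boot all_algebra.
From mathcomp Require Import finmap boolp.
From mathcomp.multinomials Require Import monalg.
From Stdlib Require Import Relations.

Set Implicit Arguments.
Unset Strict Implicit.
Unset Printing Implicit Defensive.

Import GRing.Theory.
Local Open Scope fset_scope.
Local Open Scope ring_scope.
Local Open Scope quotient_scope.

(* Subspaces, ideals and gradings are given by Prop-valued predicates, and
   quotients are taken classically. *)

Section Subspaces.
Variables (k : fieldType) (M : lmodType k).

Inductive lspan (S : M -> Prop) : M -> Prop :=
| lspan0 : lspan S 0
| lspanD c x y : S x -> lspan S y -> lspan S (c *: x + y).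

Definition subspace_add (P Q : M -> Prop) (x : M) : Prop :=
  exists y z, [/\ P y, Q z & x = y + z].

Variable S : M -> Prop.

Lemma lspan_gen x : S x -> lspan S x.
Proof. by move=> Sx; rewrite -[x]addr0 -[x]scale1r; apply: lspanD => //; left. Qed.

Lemma lspan_add x y : lspan S x -> lspan S y -> lspan S (x + y).
Proof.
move=> + Sy; elim=> [|c z t Sz _ IH]; first by rewrite add0r.
by rewrite -addrA; apply: lspanD.
Qed.

Lemma lspan_scale c x : lspan S x -> lspan S (c *: x).
Proof.
elim=> [|d z t Sz _ IH]; first by rewrite scaler0; left.
by rewrite scalerDr scalerA; apply: lspanD.
Qed.

Lemma lspan_opp x : lspan S x -> lspan S (- x).
Proof. by move=> Sx; rewrite -scaleN1r; apply: lspan_scale. Qed.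

End Subspaces.

(* The linear map from the vector space with basis X which extends f. *)
HB.lock Definition lext (k : fieldType) (X : choiceType) (W : lmodType k)
    (f : X -> W) (p : {malg k[X]}) : W :=
  \sum_(x <- msupp p) p@_x *: f x.

Section LinearExtension.
Variables (k : fieldType) (X : choiceType) (W : lmodType k).
Implicit Type f : X -> W.

Lemma lextEw f (p : {malg k[X]}) (d : {fset X}) : msupp p `<=` d ->
  lext f p = \sum_(x <- d) p@_x *: f x.
Proof.
move=> le; rewrite lext.unlock (big_fset_incl _ le) => //= x xd /mcoeff_outdom ->.
by rewrite scale0r.
Qed.

Lemma lext_is_linear f : linear (lext f).
Proof.
move=> a p q; pose d := msupp (a *: p + q) `|` (msupp p `|` msupp q).
have le1 : msupp (a *: p + q) `<=` d by apply: fsubsetUl.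
have le2 : msupp p `<=` d by rewrite fsubsetU // fsubsetUl orbT.
have le3 : msupp q `<=` d by rewrite fsubsetU // fsubsetUr orbT.
rewrite (lextEw _ le1) (lextEw _ le2) (lextEw _ le3) scaler_sumr -big_split /=.
by apply: eq_bigr => x _; rewrite mcoeffD mcoeffZ scalerDl scalerA.
Qed.

HB.instance Definition _ f :=
  GRing.isLinear.Build k {malg k[X]} W *:%R (lext f) (lext_is_linear f).

Lemma lext0 f : lext f 0 = 0.
Proof. exact: linear0. Qed.

Lemma lextU f x : lext f << x >> = f x.
Proof.
by rewrite (lextEw _ msuppU_le) big_seq_fset1 mcoeffUU scale1r.
Qed.

End LinearExtension.

Lemma malg_lin_ind (k : fieldType) (X : choiceType) (P : {malg k[X]} -> Prop) :
  P 0 -> (forall c x p, P p -> P (c *: << x >> + p)) -> forall p, P p.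
Proof.
move=> P0 PD p; rewrite [p]monalgE.
elim: (X in \sum_(i <- X) _) => [|x s IH]; first by rewrite big_nil.
rewrite big_cons; have -> : << p@_x *g x >> = p@_x *: << x >> :> {malg k[X]}.
  by apply/malgP => y; rewrite mcoeffZ !mcoeffU mulrnAr mulr1.
exact: PD.
Qed.

Lemma linear_fun0 (k : fieldType) (U W : lmodType k) (f : U -> W) :
  linear f -> f 0 = 0.
Proof. by move=> lf; have := lf (-1) 0 0; rewrite scaler0 addr0 scaleN1r addNr. Qed.

Section Quotient.
Variables (k : fieldType) (M : lmodType k) (S : M -> Prop).

Definition lspan_pred : {pred M} := fun x => `[< lspan S x >].

Fact lspan_zmod_closed : zmod_closed lspan_pred.
Proof.
split=> [|x y /asboolP Sx /asboolP Sy]; apply/asboolP; first by left.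
by apply: lspan_add => //; apply: lspan_opp.
Qed.
HB.instance Definition _ := GRing.isZmodClosed.Build M lspan_pred lspan_zmod_closed.

(* The quotient of M by the subspace spanned by S. *)
Definition lquot : Type := (Quotient.quot lspan_pred).
HB.instance Definition _ := GRing.Zmodule.on lquot.
HB.instance Definition _ := Quotient.on lquot.

Definition lpi (x : M) : lquot := \pi_(Quotient.quot lspan_pred) x.

Lemma lpi_is_zmod_morphism : zmod_morphism lpi.
Proof. exact: pi_is_zmod_morphism. Qed.
HB.instance Definition _ :=
  GRing.isZmodMorphism.Build M lquot lpi lpi_is_zmod_morphism.

Lemma lpiP x y : lpi x = lpi y <-> lspan S (x - y).
Proof.
split=> [/eqP|h]; first by rewrite -Quotient.idealrBE => /asboolP.
by apply/eqP; rewrite -Quotient.idealrBE; apply/asboolP.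
Qed.

Definition lrepr (x : lquot) : M := repr x.

Lemma lreprK : cancel lrepr lpi.
Proof. exact: reprK. Qed.

Lemma lquotW (P : lquot -> Prop) : (forall x, P (lpi x)) -> forall x, P x.
Proof. by move=> h x; rewrite -[x]lreprK. Qed.

Lemma lrepr_pi x : lspan S (lrepr (lpi x) - x).
Proof. by apply/lpiP; rewrite lreprK. Qed.

Definition lquot_scale (c : k) (x : lquot) : lquot := lpi (c *: lrepr x).

Lemma lquot_scaleE c x : lquot_scale c (lpi x) = lpi (c *: x).
Proof. by apply/lpiP; rewrite -scalerBr; apply/lspan_scale/lrepr_pi. Qed.

Fact lquot_scaleA a b v : lquot_scale a (lquot_scale b v) = lquot_scale (a * b) v.
Proof. by elim/lquotW: v => v; rewrite !lquot_scaleE scalerA. Qed.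
Fact lquot_scale1 : left_id 1 lquot_scale.
Proof. by elim/lquotW => v; rewrite lquot_scaleE scale1r. Qed.
Fact lquot_scaleDr : right_distributive lquot_scale +%R.
Proof.
move=> a x y; elim/lquotW: x => x; elim/lquotW: y => y.
by rewrite -raddfD !lquot_scaleE scalerDr raddfD.
Qed.
Fact lquot_scaleDl v : {morph lquot_scale^~ v : a b / a + b}.
Proof. by elim/lquotW: v => v a b; rewrite !lquot_scaleE scalerDl raddfD. Qed.

HB.instance Definition _ := GRing.Zmodule_isLmodule.Build k lquot
  lquot_scaleA lquot_scale1 lquot_scaleDr lquot_scaleDl.

Lemma lpi_is_scalable : scalable lpi.
Proof. by move=> c x; rewrite -lquot_scaleE. Qed.
HB.instance Definition _ :=
  GRing.isScalable.Build k M lquot *:%R lpi lpi_is_scalable.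

End Quotient.

Section Tensor.
Variables (k : fieldType) (U V : lmodType k).

Local Notation F := {malg k[(U * V)%type]}.

Variant tensor_rel : F -> Prop :=
| TensorRelL c u u' v :
    tensor_rel (<< (c *: u + u', v) >> - (c *: << (u, v) >> + << (u', v) >>))
| TensorRelR c u v v' :
    tensor_rel (<< (u, c *: v + v') >> - (c *: << (u, v) >> + << (u, v') >>)).

Definition tensor := lquot tensor_rel.
HB.instance Definition _ := GRing.Lmodule.on tensor.

Definition tpure (u : U) (v : V) : tensor := lpi tensor_rel << (u, v) >>.

(* The linear map induced by f; it is only meaningful when f is bilinear. *)
Definition tlift (W : lmodType k) (f : U -> V -> W) (t : tensor) : W :=
  lext (fun p => f p.1 p.2) (lrepr t).

End Tensor.

Arguments tensor k (U V)%_type_scope.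
Notation "U ⊗ V" := (tensor U V) (at level 40, left associativity) : type_scope.
Notation "u ⊗ v" := (tpure u v) (at level 40, left associativity) : ring_scope.

Definition bilinear (k : fieldType) (U V W : lmodType k) (f : U -> V -> W) : Prop :=
  (forall u, linear (f u)) /\ (forall v, linear (f^~ v)).

Section TensorTheory.
Variables (k : fieldType) (U V W : lmodType k).

Lemma tpure_bilinear : bilinear (@tpure k U V).
Proof.
split=> [u c v v'|v c u u']; rewrite /tpure -linearP; apply/lpiP/lspan_gen.
- exact: TensorRelR.
- exact: TensorRelL.
Qed.

Lemma tensor_ind (P : U ⊗ V -> Prop) :
  P 0 -> (forall c u v t, P t -> P (c *: (u ⊗ v) + t)) -> forall t, P t.
Proof.
move=> P0 PD t; elim/lquotW: t; elim/malg_lin_ind => [|c [u v] p IH].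
  by rewrite linear0.
by rewrite linearP; apply: PD.
Qed.

Variable f : U -> V -> W.
Hypothesis bf : bilinear f.

Lemma tlift_piE p : tlift f (lpi _ p) = lext (fun p => f p.1 p.2) p.
Proof.
have h := lrepr_pi (@tensor_rel k U V) p.
rewrite /tlift; apply/eqP; rewrite -subr_eq0 -linearB; apply/eqP.
elim: h => [|c x y Sx _ IH]; first by rewrite linear0.
rewrite linearP IH addr0; case: Sx => [a u u' v|a u v v'].
- by rewrite linearB linearP /= !lextU /= (bf.2 v) subrr scaler0.
- by rewrite linearB linearP /= !lextU /= (bf.1 u) subrr scaler0.
Qed.

Lemma tlift_pure u v : tlift f (u ⊗ v) = f u v.
Proof. by rewrite /tpure tlift_piE lextU. Qed.

Lemma tlift_linear : linear (tlift f).
Proof.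
move=> a x y; elim/lquotW: x => x; elim/lquotW: y => y.
by rewrite -linearP !tlift_piE linearP.
Qed.

End TensorTheory.

Section GroupAlgebraDef.
Variables (k : fieldType) (G : groupType).

(* The group algebra kG: finitely supported functions with convolution. *)
Definition galg : Type := {malg k[G]}.
HB.instance Definition _ := GRing.Lmodule.on galg.

Definition gelt (g : G) : galg := << g >>.

End GroupAlgebraDef.
Arguments gelt {k G} g.

HB.lock Definition gmul (k : fieldType) (G : groupType) (x y : galg k G) : galg k G :=
  lext (fun g => lext (fun h => gelt (g * h)%g) y) x.

Section GroupAlgebra.
Variables (k : fieldType) (G : groupType).
Local Notation galg := (galg k G).
Local Notation gelt := (@gelt k G).
Local Notation gmul := (@gmul k G).

Lemma galg_ind (P : galg -> Prop) :
  P 0 -> (forall c g x, P x -> P (c *: gelt g + x)) -> forall x, P x.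
Proof. exact: malg_lin_ind. Qed.

Lemma gmul_eltl g y : gmul (gelt g) y = lext (fun h => gelt (g * h)%g) y.
Proof. by rewrite gmul.unlock; apply: lextU. Qed.

Lemma gmul_elt g h : gmul (gelt g) (gelt h) = gelt (g * h)%g.
Proof. by rewrite gmul_eltl; apply: lextU. Qed.

Lemma gmul_bilinear : bilinear gmul.
Proof.
split=> [x c y z|y c x z]; last by rewrite gmul.unlock; apply: lext_is_linear.
elim/galg_ind: x => [|a g x IH]; first by rewrite gmul.unlock !lext0 scaler0 addr0.
have gmulP b u v w : gmul (b *: u + v) w = b *: gmul u w + gmul v w.
  by rewrite gmul.unlock; apply: lext_is_linear.
rewrite !gmulP IH !gmul_eltl lext_is_linear !scalerDr.
rewrite !scalerA (mulrC a c); move: (_ *: _) (_ *: _) (gmul x z) (_ *: _).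
by move=> p q r s; rewrite addrACA.
Qed.

Let gmulDl x y z : gmul (x + y) z = gmul x z + gmul y z.
Proof. by have := gmul_bilinear.2 z 1 x y; rewrite !scale1r. Qed.
Let gmulDr x y z : gmul x (y + z) = gmul x y + gmul x z.
Proof. by have := gmul_bilinear.1 x 1 y z; rewrite !scale1r. Qed.
Let gmul0l z : gmul 0 z = 0.
Proof. exact: (linear_fun0 (gmul_bilinear.2 z)). Qed.
Let gmul0r z : gmul z 0 = 0.
Proof. exact: (linear_fun0 (gmul_bilinear.1 z)). Qed.
Let gmulPl c x y z : gmul (c *: x + y) z = c *: gmul x z + gmul y z.
Proof. exact: gmul_bilinear.2. Qed.
Let gmulPr c x y z : gmul x (c *: y + z) = c *: gmul x y + gmul x z.
Proof. exact: gmul_bilinear.1. Qed.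

Fact gmulA : associative gmul.
Proof.
move=> x y z; elim/galg_ind: x => [|c g x IH]; first by rewrite !gmul0l.
rewrite !gmulPl IH; apply: (congr1 (fun t => c *: t + _)).
elim/galg_ind: y {IH} => [|b h y IH]; first by rewrite gmul0r !gmul0l gmul0r.
rewrite gmulPl !gmulPr gmulPl IH; apply: (congr1 (fun t => b *: t + _)).
elim/galg_ind: z {IH} => [|d l z IH]; first by rewrite !gmul0r.
by rewrite !gmulPr IH !gmul_elt mulgA.
Qed.

Fact gmul1l : left_id (gelt 1%g) gmul.
Proof.
elim/galg_ind => [|a g x IH]; first by rewrite gmul0r.
by rewrite gmulPr IH gmul_elt mul1g.
Qed.

Fact gmul1r : right_id (gelt 1%g) gmul.
Proof.
elim/galg_ind => [|a g x IH]; first by rewrite gmul0l.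
by rewrite gmulPl IH gmul_elt mulg1.
Qed.

Fact gelt1_neq0 : gelt 1%g != 0.
Proof. by rewrite /gelt monalgU_eq0 oner_neq0. Qed.

HB.instance Definition _ := GRing.Zmodule_isNzRing.Build galg
  gmulA gmul1l gmul1r gmulDl gmulDr gelt1_neq0.

Fact galg_scaleAl (a : k) (x y : galg) : a *: (x * y) = a *: x * y.
Proof. by have := gmulPl a x 0 y; rewrite addr0 gmul0l addr0 => /esym. Qed.
HB.instance Definition _ := GRing.Lmodule_isLalgebra.Build k galg galg_scaleAl.

Fact galg_scaleAr (a : k) (x y : galg) : a *: (x * y) = x * (a *: y).
Proof. by have := gmulPr a x y 0; rewrite addr0 gmul0r addr0 => /esym. Qed.
HB.instance Definition _ := GRing.Lalgebra_isAlgebra.Build k galg galg_scaleAr.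

Definition gcomul : galg -> galg ⊗ galg := lext (fun g => gelt g ⊗ gelt g).
Definition gcounit : galg -> k^o := lext (fun=> 1).
Definition gantipode : galg -> galg := lext (fun g => gelt g^-1%g).

End GroupAlgebra.

Section FreeAlgebra.
Variables (k : fieldType) (X : choiceType).

(* The free algebra on X. *)
Definition falg : Type := {malg k[{fmonom X}]}.
HB.instance Definition _ := GRing.Lalgebra.on falg.

Fact malg_scaleAr (a : k) (x y : {malg k[{fmonom X}]}) : a *: (x * y) = x * (a *: y).
Proof.
apply/malgP => m; rewrite mcoeffZ mcoeffMl.
rewrite (mcoeffMlw _ (fsubset_refl _) (msuppZ_le a y)) mulr_sumr.
apply: eq_bigr => p _; rewrite mulr_sumr; apply: eq_bigr => q _.
by rewrite mcoeffZ mulrnAr mulrCA.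
Qed.
Fact falg_scaleAr (a : k) (x y : falg) : a *: (x * y) = x * (a *: y).
Proof. exact: malg_scaleAr. Qed.
HB.instance Definition _ := GRing.Lalgebra_isAlgebra.Build k falg falg_scaleAr.

Definition fgen (i : X) : falg := << fmu i >>.

Definition feval (B : algType k) (f : X -> B) : falg -> B :=
  lext (fun m : {fmonom X} => \prod_(i <- m) f i).

End FreeAlgebra.

Section Ideals.
Variables (k : fieldType) (A : algType k).

Definition ideal_gen (S : A -> Prop) : A -> Prop :=
  lspan (fun x => exists a s b, S s /\ x = a * s * b).

Definition is_ideal (I : A -> Prop) : Prop :=
  [/\ I 0, forall c x y, I x -> I y -> I (c *: x + y)
    & forall a x b, I x -> I (a * x * b)].

End Ideals.

Section Presentation.
Variables (k : fieldType) (X : choiceType) (A : algType k).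

(* A is the algebra with generators gen x, x : X, and relations R = 0. *)
Definition presented (gen : X -> A) (R : falg k X -> Prop) : Prop :=
  (forall a, exists p, feval gen p = a) /\
  (forall p, feval gen p = 0 <-> ideal_gen R p).

End Presentation.

Section TensorOperations.
Variable k : fieldType.

Definition tmap (U U' V V' : lmodType k) (f : U -> U') (g : V -> V') :
    U ⊗ V -> U' ⊗ V' :=
  tlift (fun u v => f u ⊗ g v).

Definition tassoc (U V W : lmodType k) : (U ⊗ V) ⊗ W -> U ⊗ (V ⊗ W) :=
  tlift (fun t w => tlift (fun u v => u ⊗ (v ⊗ w)) t).

(* The image of P ⊗ Q in U ⊗ V, for subspaces P of U and Q of V. *)
Definition tsub (U V : lmodType k) (P : U -> Prop) (Q : V -> Prop) :
    U ⊗ V -> Prop :=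
  lspan (fun t => exists u v, [/\ P u, Q v & t = u ⊗ v]).

Definition tmul (A B : algType k) (s t : A ⊗ B) : A ⊗ B :=
  tlift (fun a b => tlift (fun a' b' => (a * a') ⊗ (b * b')) t) s.

End TensorOperations.

Section Bialgebras.
Variable k : fieldType.

Record bialgebra (A : algType k) := Bialgebra {
  comul : {linear A -> (A ⊗ A)%type};
  counit : {lrmorphism A -> k^o};
  comul1 : comul 1 = 1 ⊗ 1;
  comulM : forall a b, comul (a * b) = tmul (comul a) (comul b);
  comulA : forall a, tassoc (tmap comul id (comul a)) = tmap id comul (comul a);
  counitl : forall a, tlift (fun x y => counit x *: y) (comul a) = a;
  counitr : forall a, tlift (fun x y => counit y *: x) (comul a) = a
}.

Definition bialg_morphism (A A' : algType k) (B : bialgebra A)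
    (B' : bialgebra A') (f : {lrmorphism A -> A'}) : Prop :=
  (forall a, comul B' (f a) = tmap f f (comul B a)) /\
  (forall a, counit B' (f a) = counit B a).

Variables (A : algType k) (B : bialgebra A).

Definition antipode (S : {linear A -> A}) : Prop :=
  (forall a, tlift (fun x y => S x * y) (comul B a) = counit B a *: 1) /\
  (forall a, tlift (fun x y => x * S y) (comul B a) = counit B a *: 1).

Definition grouplike (g : A) : Prop := comul B g = g ⊗ g /\ counit B g = 1.

Definition coideal (J : A -> Prop) : Prop :=
  forall x, J x ->
  subspace_add (tsub J (fun=> True)) (tsub (fun=> True) J) (comul B x) /\
  counit B x = 0.

(* The edge h -> g. *)
Definition skew_primitive_edge (h g : {x : A | grouplike x}) : Prop :=
  exists2 x : A, ~ lspan grouplike x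
    & comul B x = x ⊗ proj1_sig g + proj1_sig h ⊗ x.

Definition indecomposable : Prop :=
  forall g h, clos_refl_sym_trans _ skew_primitive_edge g h.

End Bialgebras.

Section TensorAlgebra.
Variables (k : fieldType) (V : vectType k).

(* T(V), as the free algebra on a basis of V. *)
Definition tens : algType k := falg k 'I_(\dim {:V}).

Definition tens_in (v : V) : tens :=
  \sum_i coord (vbasis {:V}) i v *: fgen k i.

(* The algebra morphism extending a linear map f. *)
Definition tens_lift (A : algType k) (f : V -> A) : tens -> A :=
  feval (fun i : 'I_(\dim {:V}) => f (vbasis {:V})`_i).

Definition tens_prod (s : seq V) : tens := \prod_(v <- s) tens_in v.

Definition tens_deg (n : nat) : tens -> Prop :=
  lspan (fun x => exists2 s, size s = n & x = tens_prod s).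

Definition tens_gt1 : tens -> Prop :=
  lspan (fun x => exists2 n, (1 < n)%N & tens_deg n x).

Definition homogeneous_ideal (I : tens -> Prop) : Prop :=
  is_ideal I /\
  forall x, I x -> ideal_gen (fun y => I y /\ exists n, tens_deg n y) x.

(* The multiplicative extension to T(V) of a grading of V by a group. *)
Definition tens_gdeg (G : groupType) (deg : V -> G -> Prop) (g : G) :
    tens -> Prop :=
  lspan (fun x => exists s : seq (V * G),
    [/\ forall p, p \in s -> deg p.1 p.2,
        g = (\prod_(p <- s) p.2)%g & x = tens_prod (unzip1 s)]).

Definition graded_subspace (G : groupType) (deg : V -> G -> Prop)
    (I : tens -> Prop) : Prop :=
  forall x, I x -> lspan (fun y => I y /\ exists g, tens_gdeg deg g y) x.

End TensorAlgebra.

Section Representations.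
Variables (k : fieldType) (G : groupType).
Local Notation kG := (galg k G).

(* Modules over kG are given by the action of the group elements. *)
Definition is_rep (V : lmodType k) (act : G -> V -> V) : Prop :=
  [/\ forall g, linear (act g), forall v, act 1%g v = v
    & forall g h v, act (g * h)%g v = act g (act h v)].

Definition act_alg (V : lmodType k) (act : G -> V -> V) (h : kG) (v : V) : V :=
  lext (act^~ v) h.

Definition ract_alg (V : lmodType k) (ract : V -> G -> V) (v : V) (h : kG) : V :=
  lext (ract v) h.

Definition perfect_pairing (V W : vectType k) (pair : W -> V -> k^o) : Prop :=
  [/\ bilinear pair, forall f, (forall v, pair f v = 0) -> f = 0
    & forall v, (forall f, pair f v = 0) -> v = 0].

(* W is the dual of the module V, with right action ract. *)
Definition dual_rep (V W : vectType k) (act : G -> V -> V)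
    (ract : W -> G -> W) (pair : W -> V -> k^o) : Prop :=
  [/\ is_rep act, perfect_pairing pair
    & forall f g v, pair (ract f g) v = pair f (act g v)].

Record yetter_drinfeld (V : lmodType k) (act : G -> V -> V)
    (coact : V -> kG ⊗ V) : Prop := {
  yd_rep : is_rep act;
  yd_linear : linear coact;
  yd_coassoc : forall v,
    tassoc (tmap (@gcomul k G) id (coact v)) = tmap id coact (coact v);
  yd_counit : forall v, tlift (fun (h : kG) w => gcounit h *: w) (coact v) = v;
  yd_compat : forall g v,
    tmap (fun h : kG => gelt g * h) (act g) (coact v) =
    tmap (fun h : kG => h * gelt g) id (coact (act g v))
}.

End Representations.

Section BraidedDoubles.
Variables (k : fieldType) (G : groupType).
Local Notation kG := (galg k G).

(* W is the dual of V; bd_alg is an algebra with maps from V, kG and W. *)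
Record braided_data := BraidedData {
  bd_V : vectType k;
  bd_W : vectType k;
  bd_pair : bd_W -> bd_V -> k^o;
  bd_act : G -> bd_V -> bd_V;
  bd_ract : bd_W -> G -> bd_W;
  bd_beta : bd_W -> bd_V -> kG;
  bd_alg : algType k;
  bd_v : {linear bd_V -> bd_alg};
  bd_h : {lrmorphism kG -> bd_alg};
  bd_f : {linear bd_W -> bd_alg}
}.

Variable b : braided_data.
Local Notation V := (bd_V b).
Local Notation W := (bd_W b).
Local Notation D := (bd_alg b).

Definition bd_generators : choiceType := (V + kG + W)%type.

Definition bd_gen (x : bd_generators) : D :=
  match x with
  | inl (inl v) => bd_v b v
  | inl (inr h) => bd_h b h
  | inr f => bd_f b f
  end.

Let gv (v : V) : falg k bd_generators := fgen k (inl (inl v)).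
Let gh (h : kG) : falg k bd_generators := fgen k (inl (inr h)).
Let gf (f : W) : falg k bd_generators := fgen k (inr f).

(* As kG is spanned by its grouplike elements, the relations between kG and V
   or W are only needed for those. *)
Variant bd_relation : falg k bd_generators -> Prop :=
| RelLinV c u v : bd_relation (gv (c *: u + v) - (c *: gv u + gv v))
| RelLinH c h h' : bd_relation (gh (c *: h + h') - (c *: gh h + gh h'))
| RelLinW c e f : bd_relation (gf (c *: e + f) - (c *: gf e + gf f))
| RelOneH : bd_relation (gh 1 - 1)
| RelMulH h h' : bd_relation (gh (h * h') - gh h * gh h')
| RelWH f g : bd_relation
    (gf f * gh (gelt g) - gh (gelt g) * gf (bd_ract f g))
| RelHV g v : bd_relation
    (gh (gelt g) * gv v - gv (bd_act g v) * gh (gelt g))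
| RelWV f v : bd_relation (gf f * gv v - gv v * gf f - gh (bd_beta f v)).

Definition bd_mulV : tens V -> D := tens_lift (bd_v b).
Definition bd_mulW : tens W -> D := tens_lift (bd_f b).

Definition bd_mul : (tens V ⊗ kG) ⊗ tens W -> D :=
  tlift (fun t y => tlift (fun x h => bd_mulV x * bd_h b h) t * bd_mulW y).

(* bd_alg is A_beta(V, W). *)
Definition is_A_beta : Prop :=
  [/\ dual_rep (@bd_act b) (@bd_ract b) (@bd_pair b), bilinear (@bd_beta b)
    & presented bd_gen bd_relation].

Definition free_braided_double : Prop := is_A_beta /\ bijective bd_mul.

Section TriangularIdeals.
Variables (I : tens V -> Prop) (I' : tens W -> Prop).

(* The subspace I ⊗ H ⊗ T(W) + T(V) ⊗ H ⊗ I' of D. *)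
Definition tri_sub : D -> Prop :=
  lspan (fun z => exists x h y,
    (I x \/ I' y) /\ z = bd_mulV x * bd_h b h * bd_mulW y).

Record triangular_ideal : Prop := {
  tri_homV : homogeneous_ideal I;
  tri_homW : homogeneous_ideal I';
  tri_gt1V : forall x, I x -> tens_gt1 x;
  tri_gt1W : forall y, I' y -> tens_gt1 y;
  tri_invV : forall g x, I x -> I (tens_lift (fun v => tens_in (bd_act g v)) x);
  tri_invW : forall g y, I' y -> I' (tens_lift (fun f => tens_in (bd_ract f g)) y);
  tri_WI : forall x y, I x -> tri_sub (bd_mulW y * bd_mulV x);
  tri_IV : forall x y, I' y -> tri_sub (bd_mulW y * bd_mulV x)
}.

End TriangularIdeals.

Definition bd_deg (n : int) : D -> Prop :=
  lspan (fun z => exists p q x h y,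
    [/\ tens_deg p x, tens_deg q y, n = p%:Z - q%:Z
      & z = bd_mulV x * bd_h b h * bd_mulW y]).

Definition bd_deg2 (n : int) : D ⊗ D -> Prop :=
  lspan (fun t => exists i j, i + j = n /\ tsub (bd_deg i) (bd_deg j) t).

Let imV (x : D) : Prop := exists v, x = bd_v b v.
Let imH (x : D) : Prop := exists h, x = bd_h b h.
Let imW (x : D) : Prop := exists f, x = bd_f b f.

Variable B : bialgebra D.

Definition comul_closed (P : D -> Prop) : Prop :=
  forall x, P x -> tsub P P (comul B x).

Record triangular_bialgebra : Prop := {
  tb_comulH : forall h, comul B (bd_h b h) = tmap (bd_h b) (bd_h b) (gcomul h);
  tb_counitH : forall h, counit B (bd_h b h) = gcounit h;
  tb_closedVH : comul_closed (lspan (fun x => imV x \/ imH x));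
  tb_closedHW : comul_closed (lspan (fun x => imH x \/ imW x));
  tb_comul_graded : forall n x, bd_deg n x -> bd_deg2 n (comul B x);
  tb_counit_graded : forall n x, bd_deg n x -> n != 0 -> counit B x = 0;
  tb_comulV : forall v,
    subspace_add (tsub imV imH) (tsub imH imV) (comul B (bd_v b v));
  tb_comulW : forall f,
    subspace_add (tsub imW imH) (tsub imH imW) (comul B (bd_f b f))
}.

(* The right degree is read off the component of the coproduct in V ⊗ H, the
   left degree off the one in H ⊗ V; likewise for W. *)
Definition rdegV (v : V) (g : G) : Prop :=
  exists2 t, tsub imH imV t
    & comul B (bd_v b v) = bd_v b v ⊗ bd_h b (gelt g) + t.
Definition ldegV (v : V) (g : G) : Prop :=
  exists2 t, tsub imV imH t
    & comul B (bd_v b v) = t + bd_h b (gelt g) ⊗ bd_v b v.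
Definition rdegW (f : W) (g : G) : Prop :=
  exists2 t, tsub imH imW t
    & comul B (bd_f b f) = bd_f b f ⊗ bd_h b (gelt g) + t.
Definition ldegW (f : W) (g : G) : Prop :=
  exists2 t, tsub imW imH t
    & comul B (bd_f b f) = t + bd_h b (gelt g) ⊗ bd_f b f.

Record triangular_hopf_ideal (I : tens V -> Prop) (I' : tens W -> Prop) :
    Prop := {
  thi_triangular : triangular_ideal I I';
  thi_coideal : coideal B (tri_sub I I');
  thi_rgradedV : graded_subspace rdegV I;
  thi_lgradedV : graded_subspace ldegV I;
  thi_rgradedW : graded_subspace rdegW I';
  thi_lgradedW : graded_subspace ldegW I'
}.

End BraidedDoubles.

Arguments bd_pair {k G b}.
Arguments bd_act {k G b}.
Arguments bd_ract {k G b}.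
Arguments bd_beta {k G b}.

(* A is the quotient of A' by J, through the projection f. *)
Definition quotient_map (k : fieldType) (A' A : algType k)
    (f : {lrmorphism A' -> A}) (J : A' -> Prop) : Prop :=
  (forall a, exists x, f x = a) /\ (forall x, f x = 0 <-> J x).

Section TriangularDecomposition.
Variables (k : fieldType) (G : groupType) (A : algType k) (B : bialgebra A).

(* A triangular decomposition of B over kG, which presents it as the quotient of
   a free one by a triangular Hopf ideal. *)
Record triangular_decomposition := TriangularDecomposition {
  td_data : braided_data k G;
  td_bialg : bialgebra (bd_alg td_data);
  td_I : tens (bd_V td_data) -> Prop;
  td_I' : tens (bd_W td_data) -> Prop;
  td_proj : {lrmorphism bd_alg td_data -> A};
  td_free : free_braided_double td_data;
  td_triangular : triangular_bialgebra td_bialg;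
  td_hopf_ideal : triangular_hopf_ideal td_bialg td_I td_I';
  td_morphism : bialg_morphism td_bialg B td_proj;
  td_quotient : quotient_map td_proj (tri_sub td_I td_I')
}.

Local Notation V T := (bd_V (td_data T)).
Local Notation W T := (bd_W (td_data T)).

Definition elt_v T (v : V T) : A := td_proj T (bd_v _ v).
Definition elt_f T (f : W T) : A := td_proj T (bd_f _ f).
Definition elt_g T (g : G) : A := td_proj T (bd_h _ (gelt g)).

(* v and f are homogeneous bases with pairwise distinct degrees. *)
Definition separated_bases T n (v : n.-tuple (V T)) (f : n.-tuple (W T)) : Prop :=
  let B0 := td_bialg T in
  basis_of fullv v /\ basis_of fullv f /\
  exists rv lv rf lf : 'I_n -> G,
    [/\ injective rv, injective lv, injective rf & injective lf] /\
    forall i, [/\ rdegV B0 (tnth v i) (rv i), ldegV B0 (tnth v i) (lv i),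
                  rdegW B0 (tnth f i) (rf i) & ldegW B0 (tnth f i) (lf i)].

Inductive subgroup_gen (S : G -> Prop) : G -> Prop :=
| Sgen1 : subgroup_gen S 1%g
| SgenM x y : S x -> subgroup_gen S y -> subgroup_gen S (x * y)%g
| SgenV x y : S x -> subgroup_gen S y -> subgroup_gen S (x^-1 * y)%g.

Record normal_form T n (v : n.-tuple (V T)) (f : n.-tuple (W T))
    (K L : 'I_n -> G) (lam : 'I_n -> G -> k) (gam : 'I_n -> 'I_n -> k) :
    Prop := {
  nf_gen : forall g, subgroup_gen (fun x => exists i, x = K i \/ x = L i) g;
  nf_comm : forall i j, commute (K i) (L j);
  nf_basisV : basis_of fullv v;
  nf_basisW : basis_of fullv f;
  nf_comulV : forall i, let x := bd_v (td_data T) (tnth v i) in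
    comul (td_bialg T) x = x ⊗ bd_h _ (gelt (K i)) + 1 ⊗ x;
  nf_comulW : forall i, let y := bd_f (td_data T) (tnth f i) in
    comul (td_bialg T) y = y ⊗ 1 + bd_h _ (gelt (L i)) ⊗ y;
  nf_char1 : forall i, lam i 1%g = 1;
  nf_charM : forall i g h, lam i (g * h)%g = lam i g * lam i h;
  nf_act : forall i g, bd_act g (tnth v i) = lam i g *: tnth v i;
  nf_ract : forall i g, bd_ract (tnth f i) g = lam i g *: tnth f i;
  nf_lamKL : forall i j, lam j (K i) = (lam i (L j))^-1;
  nf_beta : forall i j,
    bd_beta (tnth f i) (tnth v j) = gam i j *: (gelt (K j) - gelt (L i));
  nf_gam : forall i j, lam i <> lam j -> gam i j = 0
}.

(* The generators of T are those of T0, rescaled by elements of the same copy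
   of G in A. *)
Definition rescaling T0 T n (v0 : n.-tuple (V T0)) (f0 : n.-tuple (W T0))
    (v : n.-tuple (V T)) (f : n.-tuple (W T)) : Prop :=
  (forall g, elt_g T g = elt_g T0 g) /\
  forall i, (exists g, elt_v (tnth v i) = elt_v (tnth v0 i) * elt_g T0 g) /\
            (exists g, elt_f (tnth f i) = elt_f (tnth f0 i) * elt_g T0 g).

(* B has a triangular decomposition of weakly separable type, whose normal form
   is of separable type and non-degenerate. *)
Definition separable_nondegenerate : Prop :=
  exists T0 T n (v0 : n.-tuple (V T0)) (f0 : n.-tuple (W T0))
    (v : n.-tuple (V T)) (f : n.-tuple (W T)) K L lam gam,
  [/\ separated_bases v0 f0, normal_form v f K L lam gam,
      rescaling v0 f0 v f, injective lam & forall i, gam i i != 0].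

End TriangularDecomposition.

Section AsymmetricDoubles.
Variables (k : fieldType) (G : groupType).
Local Notation kG := (galg k G).

Record asymmetric_data := AsymmetricData {
  ad_V : vectType k;
  ad_W : vectType k;
  ad_pair : ad_W -> ad_V -> k^o;
  ad_act : G -> ad_V -> ad_V;
  ad_ract : ad_W -> G -> ad_W;
  ad_coactV : ad_V -> kG ⊗ ad_V;
  ad_coactW : ad_W -> kG ⊗ ad_W;
  ad_alg : algType k;
  ad_v : {linear ad_V -> ad_alg};
  ad_h : {lrmorphism kG -> ad_alg};
  ad_f : {linear ad_W -> ad_alg}
}.

Variable a : asymmetric_data.
Local Notation V := (ad_V a).
Local Notation W := (ad_W a).

(* W is a left module through f |-> ract f g^-1.  In ad_compat the coaction of V
   must act on W by the transpose ract of its action on V: this is what makes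
   the coproduct compatible with the commutation relations between W and V. *)
Record yetter_drinfeld_pair : Prop := {
  ad_dual : dual_rep (@ad_act a) (@ad_ract a) (@ad_pair a);
  ad_ydV : yetter_drinfeld (@ad_act a) (@ad_coactV a);
  ad_ydW : yetter_drinfeld (fun g f => @ad_ract a f g^-1%g) (@ad_coactW a);
  ad_compat : forall (v : V) (f : W),
    tlift (fun h f0 => act_alg (@ad_act a) h v ⊗ f0) (ad_coactW f) =
    tlift (fun h v0 => v0 ⊗ ract_alg (@ad_ract a) f h) (ad_coactV v)
}.

(* gantipode is its own inverse. *)
Definition ad_beta (f : W) (v : V) : kG :=
  tlift (fun h v0 => ad_pair f v0 *: gantipode h) (ad_coactV v)
  - tlift (fun h f0 => ad_pair f0 v *: h) (ad_coactW f).

Definition ad_braided : braided_data k G :=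
  BraidedData (@ad_pair a) (@ad_act a) (@ad_ract a) ad_beta
    (ad_v a) (ad_h a) (ad_f a).

Record asymmetric_hopf (B : bialgebra (ad_alg a))
    (S : {linear ad_alg a -> ad_alg a}) : Prop := {
  ah_antipode : antipode B S;
  ah_comulH : forall h, comul B (ad_h a h) = tmap (ad_h a) (ad_h a) (gcomul h);
  ah_comulV : forall v, comul B (ad_v a v) =
    tlift (fun h v0 => ad_v a v0 ⊗ ad_h a (gantipode h)) (ad_coactV v)
    + 1 ⊗ ad_v a v;
  ah_comulW : forall f, comul B (ad_f a f) =
    ad_f a f ⊗ 1 + tlift (fun h f0 => ad_h a h ⊗ ad_f a f0) (ad_coactW f);
  ah_counitH : forall h, counit B (ad_h a h) = gcounit h;
  ah_counitV : forall v, counit B (ad_v a v) = 0;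
  ah_counitW : forall f, counit B (ad_f a f) = 0;
  ah_antipodeV : forall v, S (ad_v a v) =
    - tlift (fun h v0 => ad_v a v0 * ad_h a h) (ad_coactV v);
  ah_antipodeW : forall f, S (ad_f a f) =
    - tlift (fun h f0 => ad_h a (gantipode h) * ad_f a f0) (ad_coactW f)
}.

End AsymmetricDoubles.

(* B is isomorphic, as a Hopf algebra, to the quotient of an asymmetric braided
   Drinfeld double by a triangular Hopf ideal. *)
Definition asymmetric_braided_double (k : fieldType) (G : groupType)
    (A : algType k) (B : bialgebra A) : Prop :=
  exists a : asymmetric_data k G,
    yetter_drinfeld_pair a /\ free_braided_double (ad_braided a) /\
  exists (B' : bialgebra (bd_alg (ad_braided a))) (S' : {linear ad_alg a -> ad_alg a}),
    asymmetric_hopf B' S' /\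
  exists (I : tens (bd_V (ad_braided a)) -> Prop)
         (I' : tens (bd_W (ad_braided a)) -> Prop),
    triangular_hopf_ideal B' I I' /\
  exists (S : {linear A -> A}) (pr : {lrmorphism bd_alg (ad_braided a) -> A}),
  [/\ antipode B S, bialg_morphism B' B pr, forall x, pr (S' x) = S (pr x)
    & quotient_map pr (tri_sub I I')].

(* Main.v *)
From Pilot Require Import Defs.
From HB Require Import structures.
From mathcomp Require Import all_boot all_algebra.
From mathcomp Require Import boolp.
From mathcomp.multinomials Require Import monalg.
(* After this import, bilinear is the predicate on curried functions. *)
Import Pilot.Defs.
Local Open Scope ring_scope.

(** A normal form already is the presentation of an asymmetric braided Drinfeld
    double.  Let V be graded by assigning the degree k_i^-1 to v_i, let V* be
    graded by assigning l_i to f_i, and replace the pairing by the one in which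
    f_i and v_j pair to gamma_ii if i = j and to 0 otherwise.  It is perfect as
    all gamma_ii are nonzero, and invariant as v_i and f_i have the same
    character.  Since the characters are pairwise distinct, gamma_ij = 0 for
    distinct i and j, so the commutator attached to these coactions and this
    pairing is gamma_ij (k_j - l_i), the given one ([ad_betaE]).  The condition
    that relates the two coactions is lambda_i (k_j) = lambda_j (l_i)^-1, and the
    Yetter--Drinfeld condition for a diagonal module says that the degrees are
    central.  They are because G is abelian ([normal_form_abelian]): the
    commutator gamma_ii (k_i - l_i) of f_i and v_i commutes with G, as
    conjugation multiplies f_i and v_i by inverse scalars, and the k's commute
    with the l's.

    What remains is that the free double and its quotient A have antipodes
    which the projection intertwines.  Both are generated by a group of
    grouplike elements and by skew-primitive elements, so that Takeuchi's
    criterion applies ([antipode_exists]): the words with at most n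
    skew-primitive letters span a coalgebra filtration, and an inverse of the
    identity for the convolution product on the group algebra is improved step by
    step along it.  The starting point is a linear map that inverts the
    grouplikes; it comes from the triangular decomposition, which retracts the
    double onto kG, and it descends to A because a triangular ideal lies in
    tensor degrees greater than 1.  The antipode identity
    determines the antipodes on the generators ([antipode_skew]), and they are
    compatible with the projection because convolution inverses are unique
    ([antipode_morph]). *)

Set Implicit Arguments.
Unset Strict Implicit.
Unset Printing Implicit Defensive.

Import GRing.Theory.

(** * Linear maps out of tensor products *)

Section LinearMaps.
Variables (k : fieldType).
Implicit Types U V W P : lmodType k.

Lemma linear_funP U V (f : U -> V) : linear f -> exists g : {linear U -> V}, f = g.
Proof.
move=> lf; pose L := GRing.isLinear.Build k U V *:%R f lf.
by exists (HB.pack_for {linear U -> V} f L).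
Qed.

Lemma linear_funD U V (f : U -> V) x y : linear f -> f (x + y) = f x + f y.
Proof. by move=> lf; rewrite -[x]scale1r lf !scale1r. Qed.

Lemma linear_funZ U V (f : U -> V) c x : linear f -> f (c *: x) = c *: f x.
Proof. by move=> lf; rewrite -[c *: x]addr0 lf (linear_fun0 lf) addr0. Qed.

Lemma linear_fun_sum U V (f : U -> V) I (r : seq I) (F : I -> U) :
  linear f -> f (\sum_(i <- r) F i) = \sum_(i <- r) f (F i).
Proof.
by move=> lf; apply: big_morph => [x y|]; rewrite ?linear_funD ?linear_fun0.
Qed.

Lemma linear_fun_add U V (f g : U -> V) :
  linear f -> linear g -> linear (fun x => f x + g x).
Proof. by move=> lf lg c x y; rewrite lf lg scalerDr addrACA. Qed.

Lemma linear_comp U V W (f : V -> W) (g : U -> V) :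
  linear f -> linear g -> linear (fun x => f (g x)).
Proof. by move=> lf lg c x y; rewrite lg lf. Qed.

Lemma tensor_ext U V W (F F' : U ⊗ V -> W) : linear F -> linear F' ->
  (forall u v, F (u ⊗ v) = F' (u ⊗ v)) -> F =1 F'.
Proof.
move=> lF lF' e; elim/tensor_ind => [|c u v t IH].
  by rewrite !linear_fun0.
by rewrite lF lF' e IH.
Qed.

Lemma bilinear_tpure U U' V V' (f : U -> U') (g : V -> V') :
  linear f -> linear g -> bilinear (fun u v => f u ⊗ g v).
Proof.
move=> lf lg; have [bl br] := tpure_bilinear U' V'.
by split=> [u|v] c x y; rewrite ?lf ?lg ?bl ?(br _ c).
Qed.

Lemma tmap_linear U U' V V' (f : U -> U') (g : V -> V') :
  linear f -> linear g -> linear (tmap f g).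
Proof. by move=> lf lg; apply/tlift_linear/bilinear_tpure. Qed.

Lemma tmap_pure U U' V V' (f : U -> U') (g : V -> V') u v :
  linear f -> linear g -> tmap f g (u ⊗ v) = f u ⊗ g v.
Proof. by move=> lf lg; apply/tlift_pure/bilinear_tpure. Qed.

Lemma bilinear_comp U U' V V' W (F : U' -> V' -> W) (f : U -> U') (g : V -> V') :
  bilinear F -> linear f -> linear g -> bilinear (fun u v => F (f u) (g v)).
Proof.
move=> [bl br] lf lg.
by split=> [u|v] c x y; rewrite ?lf ?lg ?bl ?(br _ c).
Qed.

Lemma tlift_tmap U U' V V' W (F : U' -> V' -> W) (f : U -> U') (g : V -> V') t :
  bilinear F -> linear f -> linear g ->
  tlift F (tmap f g t) = tlift (fun u v => F (f u) (g v)) t.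
Proof.
move=> bF lf lg; move: t; apply: tensor_ext => [||u v].
- exact: linear_comp (tlift_linear bF) (tmap_linear lf lg).
- exact/tlift_linear/bilinear_comp.
- by rewrite tmap_pure // !tlift_pure //; apply: bilinear_comp.
Qed.

Lemma linear_tlift U V W W' (G : W -> W') (F : U -> V -> W) t :
  linear G -> bilinear F -> G (tlift F t) = tlift (fun u v => G (F u v)) t.
Proof.
move=> lG bF; have bGF : bilinear (fun u v => G (F u v)).
  by case: bF => bl br; split=> [u|v] c x y; rewrite ?bl ?(br _ c) lG.
move: t; apply: tensor_ext => [||u v].
- exact: linear_comp (tlift_linear bF).
- exact: tlift_linear.
- by rewrite !tlift_pure.
Qed.

Lemma bilinear_mul U V (A : algType k) (f : U -> A) (g : V -> A) :
  linear f -> linear g -> bilinear (fun u v => f u * g v).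
Proof.
move=> lf lg; split=> [u|v] c x y.
- by rewrite lg mulrDr scalerAr.
- by rewrite lf mulrDl scalerAl.
Qed.

Lemma tlift_param U V W P (F : P -> U -> V -> W) t :
  (forall x, bilinear (F x)) -> (forall u v, linear (fun x => F x u v)) ->
  linear (fun x => tlift (F x) t).
Proof.
move=> bF lF c x y; move: t; apply: tensor_ext => [||u v].
- exact: tlift_linear.
- move=> d s t; rewrite !(tlift_linear (bF _)) !scalerDr !scalerA mulrC.
  by rewrite -!addrA; congr (_ + _); rewrite addrCA.
- by rewrite !tlift_pure // lF.
Qed.

Lemma bilinear_tpure2 U V W (w : W) :
  bilinear (fun (u : U) (v : V) => u ⊗ (v ⊗ w)).
Proof. by apply: bilinear_tpure => //; case: (tpure_bilinear V W). Qed.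

Lemma bilinear_tassoc U V W :
  bilinear (fun t (w : W) => tlift (fun (u : U) (v : V) => u ⊗ (v ⊗ w)) t).
Proof.
split=> [t|w]; last exact/tlift_linear/bilinear_tpure2.
apply: tlift_param => [w|u v]; first exact: bilinear_tpure2.
by move=> c w w'; rewrite (tpure_bilinear V W).1 (tpure_bilinear U _).1.
Qed.

Lemma tassoc_linear U V W : linear (@tassoc k U V W).
Proof. exact/tlift_linear/bilinear_tassoc. Qed.

Lemma tassoc_pure U V W u v w :
  @tassoc k U V W ((u ⊗ v) ⊗ w) = u ⊗ (v ⊗ w).
Proof.
rewrite /tassoc tlift_pure ?tlift_pure //; last exact: bilinear_tassoc.
exact: bilinear_tpure2.
Qed.

Lemma bilinear_tmul_pure (A B : algType k) (a : A) (b : B) :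
  bilinear (fun a' b' => (a * a') ⊗ (b * b')).
Proof. by apply: bilinear_tpure => c x y; rewrite mulrDr scalerAr. Qed.

Lemma bilinear_tmul_l (A B : algType k) (t : A ⊗ B) :
  bilinear (fun a b => tlift (fun a' b' => (a * a') ⊗ (b * b')) t).
Proof.
split=> [a|b]; apply: tlift_param => [x|a' b'].
- exact: bilinear_tmul_pure.
- by move=> c x y; rewrite mulrDl -scalerAl (tpure_bilinear A B).1.
- exact: bilinear_tmul_pure.
- by move=> c x y; rewrite mulrDl -scalerAl ((tpure_bilinear A B).2 _ c).
Qed.

Lemma tmul_bilinear (A B : algType k) : bilinear (@tmul k A B).
Proof.
split=> [s|t]; last exact/tlift_linear/bilinear_tmul_l.
apply: tlift_param => [t|a b]; first exact: bilinear_tmul_l.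
exact/tlift_linear/bilinear_tmul_pure.
Qed.

Lemma tmul_pure (A B : algType k) (a a' : A) (b b' : B) :
  tmul (a ⊗ b) (a' ⊗ b') = (a * a') ⊗ (b * b').
Proof.
rewrite /tmul tlift_pure ?tlift_pure //; first exact: bilinear_tmul_pure.
exact: bilinear_tmul_l.
Qed.

End LinearMaps.

(** * Convolution *)

Section Convolution.
Variables (k : fieldType) (C A : algType k) (BC : bialgebra C).
Implicit Types f g h : {linear C -> A}.

Definition conv f g (x : C) : A := tlift (fun y z => f y * g z) (comul BC x).

Lemma bilinear_conv f g : bilinear (fun y z => f y * g z).
Proof. by apply: bilinear_mul => c x y; rewrite linearP. Qed.

Fact conv_is_linear f g : linear (conv f g).
Proof.
by move=> c x y; rewrite /conv linearP tlift_linear //; apply: bilinear_conv.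
Qed.

HB.instance Definition _ f g :=
  GRing.isLinear.Build k C A *:%R (conv f g) (conv_is_linear f g).

Definition conv_unit (x : C) : A := counit BC x *: 1.

Fact conv_unit_is_linear : linear conv_unit.
Proof. by move=> c x y; rewrite /conv_unit linearP scalerDl -scalerA. Qed.

HB.instance Definition _ :=
  GRing.isLinear.Build k C A *:%R conv_unit conv_unit_is_linear.

Lemma eq_conv f f' g g' : f =1 f' -> g =1 g' -> conv f g =1 conv f' g'.
Proof.
move=> ef eg x; rewrite /conv; congr (tlift _ _).
by apply/funext => y; apply/funext => z; rewrite ef eg.
Qed.

Lemma conv1l f : conv conv_unit f =1 f.
Proof.
move=> x; rewrite -[in RHS](counitl BC x) linear_tlift.
- rewrite /conv; congr (tlift _ _); apply/funext => y; apply/funext => z.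
  by rewrite /conv_unit -scalerAl mul1r linearZ.
- by move=> c y z; rewrite linearP.
split=> [y|y] c u v; first by rewrite scalerDr !scalerA mulrC.
by rewrite linearP scalerDl -scalerA.
Qed.

Lemma conv1r f : conv f conv_unit =1 f.
Proof.
move=> x; rewrite -[in RHS](counitr BC x) linear_tlift.
- rewrite /conv; congr (tlift _ _); apply/funext => y; apply/funext => z.
  by rewrite /conv_unit -scalerAr mulr1 linearZ.
- by move=> c y z; rewrite linearP.
split=> [y|y] c u v; first by rewrite linearP scalerDl -scalerA.
by rewrite scalerDr !scalerA mulrC.
Qed.

Lemma convA f g h : conv f (conv g h) =1 conv (conv f g) h.
Proof.
pose M x t := tlift (fun y z => f x * (g y * h z)) t.
have bfgh z : bilinear (fun x y => f x * g y * h z).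
  have [bl br] := bilinear_conv f g.
  by split=> [x|y] c u v; rewrite ?bl ?(br _ c) mulrDl -scalerAl.
have bM x : bilinear (fun y z => f x * (g y * h z)).
  have [bl br] := bilinear_conv g h.
  by split=> [y|z] c u v; rewrite ?bl ?(br _ c) mulrDr -scalerAr.
have bbM : bilinear M.
  split=> [x|t]; first exact: tlift_linear.
  by apply: tlift_param => // y z c u v; rewrite linearP mulrDl -scalerAl.
have lid (V : lmodType k) : linear (@id V) by [].
have lD : linear (comul BC) by move=> c x y; rewrite linearP.
have lA := @tassoc_linear k C C C.
have E1 t : tlift (fun x y => f x * conv g h y) t = tlift M (tmap id (comul BC) t).
  rewrite tlift_tmap //; congr (tlift _ _); apply/funext => x; apply/funext => y.
  rewrite /conv /M linear_tlift //; last exact: bilinear_conv.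
  by move=> c u v; rewrite mulrDr scalerAr.
have E2 t : tlift (fun x y => conv f g x * h y) t =
    tlift M (tassoc (tmap (comul BC) id t)).
  move: t; apply: tensor_ext => [||u v].
  - exact: tlift_linear (bilinear_conv _ _).
  - apply: linear_comp (tlift_linear bbM) _.
    exact: linear_comp (tmap_linear _ _).
  rewrite tmap_pure // tlift_pure; last exact: (bilinear_conv (conv f g) h).
  rewrite /conv.
  rewrite (linear_tlift (G := fun a => a * h v)); last 2 first.
  - by move=> c x y; rewrite mulrDl scalerAl.
  - exact: bilinear_conv.
  move: (comul BC u); apply: tensor_ext => [||x y].
  - exact: tlift_linear.
  - apply: linear_comp (tlift_linear bbM) _.
    exact: linear_comp lA ((tpure_bilinear _ _).2 v).
  by rewrite tassoc_pure !tlift_pure // /M tlift_pure // mulrA.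
by move=> x; rewrite /conv E1 E2 comulA.
Qed.

Lemma conv_inverse_unique l f r : conv l f =1 conv_unit -> conv f r =1 conv_unit ->
  l =1 r.
Proof.
move=> lf fr x; rewrite -[LHS]conv1r -[RHS]conv1l.
rewrite -(eq_conv (fun _ => erefl) fr) convA.
exact: (eq_conv lf (fun _ => erefl)).
Qed.

End Convolution.

(** * Spans *)

Lemma lspan_ext (k : fieldType) (M : lmodType k) (S P : M -> Prop) :
  P 0 -> (forall c x y, P x -> P y -> P (c *: x + y)) ->
  (forall x, S x -> P x) -> forall x, lspan S x -> P x.
Proof. by move=> P0 PD SP x; elim=> // c y z /SP Py _; apply: PD. Qed.

Lemma lspan_comb (k : fieldType) (M : lmodType k) (S : M -> Prop) c x y :
  lspan S x -> lspan S y -> lspan S (c *: x + y).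
Proof. by move=> Sx; apply/lspan_add/lspan_scale. Qed.

Lemma lspan_mono (k : fieldType) (M : lmodType k) (S S' : M -> Prop) :
  (forall x, S x -> S' x) -> forall x, lspan S x -> lspan S' x.
Proof.
move=> SS'; apply: lspan_ext; first by left.
  by move=> c x y; apply: lspan_comb.
by move=> x /SS'; apply: lspan_gen.
Qed.

Lemma linear_lspan0 (k : fieldType) (M N : lmodType k) (F : M -> N)
    (S : M -> Prop) :
  linear F -> (forall x, S x -> F x = 0) -> forall x, lspan S x -> F x = 0.
Proof.
move=> lF SF; apply: lspan_ext => //; first exact: linear_fun0.
by move=> c x y Fx Fy; rewrite lF Fx Fy scaler0 addr0.
Qed.

(** * Antipodes of bialgebras generated by grouplikes and skew-primitives *)

Section PointedAntipode.
Variables (k : fieldType) (G : groupType) (A : algType k) (B : bialgebra A).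
Variable h : G -> A.

Record grouplike_map : Prop := {
  gl_one : h 1%g = 1;
  gl_mul : forall x y, h (x * y)%g = h x * h y;
  gl_grouplike : forall x, grouplike B (h x)
}.

Definition skew_primitive (x : A) : Prop :=
  exists g g', comul B x = x ⊗ h g + h g' ⊗ x.

(** Generation as an algebra by the image of h and by skew-primitives, as an
    induction principle on words that grow to the right. *)
Definition skew_generated : Prop := forall Q : A -> Prop,
  Q 1 -> (forall c x y, Q x -> Q y -> Q (c *: x + y)) ->
  (forall x g, Q x -> Q (x * h g)) ->
  (forall x y, Q x -> skew_primitive y -> Q (x * y)) ->
  forall x, Q x.

Hypothesis hP : grouplike_map.

Lemma gl_mulV g : h g * h g^-1%g = 1.
Proof. by rewrite -(gl_mul hP) mulgV (gl_one hP). Qed.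

Lemma gl_mulVl g : h g^-1%g * h g = 1.
Proof. by rewrite -(gl_mul hP) mulVg (gl_one hP). Qed.

Lemma gl_comul g : comul B (h g) = h g ⊗ h g.
Proof. by case: (gl_grouplike hP g). Qed.

Lemma gl_counit g : counit B (h g) = 1.
Proof. by case: (gl_grouplike hP g). Qed.

(** It plays the part of the coradical filtration. *)
Fixpoint filt (n : nat) : A -> Prop :=
  if n is m.+1 then
    lspan (fun x => filt m x \/
      exists y z g, [/\ filt m y, skew_primitive z & x = y * z * h g])
  else lspan (fun x => exists g, x = h g).

Lemma filt0 n : filt n 0.
Proof. by case: n => [|n]; left. Qed.

Lemma filtD n c x y : filt n x -> filt n y -> filt n (c *: x + y).
Proof. by case: n => [|n]; apply: lspan_comb. Qed.

Lemma filtS n x : filt n x -> filt n.+1 x.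
Proof. by move=> fx; apply: lspan_gen; left. Qed.

Lemma filt_mono m n x : (m <= n)%N -> filt m x -> filt n x.
Proof.
move=> /subnK <-; elim: (n - m)%N => // d IH /IH; exact: filtS.
Qed.

Lemma filt_gl g : filt 0 (h g).
Proof. by apply: lspan_gen; exists g. Qed.

Lemma filt_mul_skew n x y g : filt n x -> skew_primitive y ->
  filt n.+1 (x * y * h g).
Proof. by move=> fx sy; apply: lspan_gen; right; exists x, y, g. Qed.

Lemma filt_ext0 (P : A -> Prop) :
  P 0 -> (forall c x y, P x -> P y -> P (c *: x + y)) ->
  (forall g, P (h g)) -> forall x, filt 0 x -> P x.
Proof. by move=> P0 PD Pg; apply: lspan_ext => // _ [g ->]. Qed.

Lemma filt_extS n (P : A -> Prop) :
  P 0 -> (forall c x y, P x -> P y -> P (c *: x + y)) ->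
  (forall x, filt n x -> P x) ->
  (forall y z g, filt n y -> skew_primitive z -> P (y * z * h g)) ->
  forall x, filt n.+1 x -> P x.
Proof.
move=> P0 PD Pn PS; apply: lspan_ext => // x [/Pn //|[y [z [g [fy sz ->]]]]].
exact: PS.
Qed.

Lemma filt_mul_gl n x g : filt n x -> filt n (x * h g).
Proof.
have fD m c y z : filt m (y * h g) -> filt m (z * h g) ->
    filt m ((c *: y + z) * h g).
  by move=> fy fz; rewrite mulrDl -scalerAl; apply: filtD.
elim: n x => [|n IH].
  apply: filt_ext0 => [||a]; [by rewrite mul0r; apply: filt0 | exact: fD |].
  by rewrite -(gl_mul hP); apply: filt_gl.
apply: filt_extS => [||y /IH|y z a fy sz].
- by rewrite mul0r; apply: filt0.
- exact: fD.
- exact: filtS.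
by rewrite -mulrA -(gl_mul hP); apply: filt_mul_skew.
Qed.

Lemma filt_exhaustive : skew_generated -> forall x, exists n, filt n x.
Proof.
apply=> [|c x y [m fx] [n fy]|x g [n fx]|x y [n fx] sy].
- by exists 0; rewrite -(gl_one hP); apply: filt_gl.
- exists (maxn m n); apply: filtD.
    by apply: filt_mono fx; rewrite leq_maxl.
  by apply: filt_mono fy; rewrite leq_maxr.
- by exists n; apply: filt_mul_gl.
- by exists n.+1; rewrite -[_ * y]mulr1 -(gl_one hP); apply: filt_mul_skew.
Qed.

Definition tspan (R : A -> A -> Prop) : A ⊗ A -> Prop :=
  lspan (fun t => exists u v, R u v /\ t = u ⊗ v).

Lemma tspan_pure (R : A -> A -> Prop) u v : R u v -> tspan R (u ⊗ v).
Proof. by move=> Ruv; apply: lspan_gen; exists u, v. Qed.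

Lemma tspan_mono (R R' : A -> A -> Prop) t : (forall u v, R u v -> R' u v) ->
  tspan R t -> tspan R' t.
Proof.
by move=> RR'; apply: lspan_mono => _ [u [v [/RR' Ruv ->]]]; exists u, v.
Qed.

Lemma tspan_tmul (R R' : A -> A -> Prop) s t :
  (forall u v, R u v -> tspan R' (tmul (u ⊗ v) s)) ->
  tspan R t -> tspan R' (tmul t s).
Proof.
move=> RR'; have [_ br] := tmul_bilinear A A; move: t; apply: lspan_ext.
- by rewrite (linear_fun0 (br s)); left.
- by move=> c x y tx ty; rewrite (br _ c); apply: lspan_comb.
by move=> _ [u [v [Ruv ->]]]; apply: RR'.
Qed.

(** The two terms of the coproduct of y g act on the right of the coproduct of x
    in different ways, so a different bound on the latter is of use for each. *)
Lemma comul_mul_skew (R1 R2 R : A -> A -> Prop) x y g :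
  tspan R1 (comul B x) -> tspan R2 (comul B x) -> skew_primitive y ->
  (forall u v g1 g2, R1 u v -> R (u * y * h g1) (v * h g2)) ->
  (forall u v g1 g2, R2 u v -> R (u * h g1) (v * y * h g2)) ->
  tspan R (comul B (x * y * h g)).
Proof.
move=> t1 t2 [a [b yE]] R1P R2P; have [bl br] := tmul_bilinear A A.
rewrite -mulrA comulM comulM yE gl_comul (linear_funD _ _ (br _)).
rewrite (linear_funD _ _ (bl _)) !tmul_pure -!(gl_mul hP).
apply: lspan_add.
  apply: tspan_tmul t1 => u v Ruv; rewrite tmul_pure mulrA.
  exact/tspan_pure/R1P.
apply: tspan_tmul t2 => u v Ruv; rewrite tmul_pure mulrA.
exact/tspan_pure/R2P.
Qed.

Lemma tspan_comul0 R : tspan R (comul B 0).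
Proof. by rewrite linear0; left. Qed.

Lemma tspan_comulD R c x y : tspan R (comul B x) -> tspan R (comul B y) ->
  tspan R (comul B (c *: x + y)).
Proof. by move=> tx ty; rewrite linearP; apply: lspan_comb. Qed.

Lemma comul_filt0 x : filt 0 x ->
  tspan (fun u v => filt 0 u /\ filt 0 v) (comul B x).
Proof.
move: x; apply: filt_ext0 => [|c y z|g].
- exact: tspan_comul0.
- exact: tspan_comulD.
by rewrite gl_comul; apply: tspan_pure; split; apply: filt_gl.
Qed.

Lemma comul_filt_l n x : filt n x -> tspan (fun u _ => filt n u) (comul B x).
Proof.
elim: n x => [|n IH]; first by move=> x /comul_filt0; apply: tspan_mono => u v [].
apply: filt_extS => [|c y z|x /IH|y z g /IH dy sz].
- exact: tspan_comul0.
- exact: tspan_comulD.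
- by apply: tspan_mono => u _; apply: filtS.
apply: (comul_mul_skew g dy dy sz) => u _ a _ fu; first exact: filt_mul_skew.
exact/filtS/filt_mul_gl.
Qed.

(** A word with n + 1 skew-primitive letters has a coproduct in which the left
    factor has lost a letter or the right factor has none: the filtration is
    one of coalgebras, starting at the span of the grouplikes. *)
Lemma comul_filt n x : filt n.+1 x ->
  tspan (fun u v => filt n u \/ filt 0 v) (comul B x).
Proof.
have old m y : filt m y -> tspan (fun u v => filt m u \/ filt 0 v) (comul B y).
  by move=> /comul_filt_l; apply: tspan_mono => u v; left.
elim: n x => [|n IH]; apply: filt_extS => [|c y z|x /old //|y z g fy sz];
  try exact: tspan_comul0; try exact: tspan_comulD.
  apply: (comul_mul_skew g (comul_filt0 fy) (comul_filt0 fy) sz)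
    => u v a b [fu fv]; [right|left]; exact: filt_mul_gl.
apply: (comul_mul_skew g (IH _ fy) (comul_filt_l fy) sz) => u v a b.
  case=> [fu|fv]; [left; exact: filt_mul_skew | right; exact: filt_mul_gl].
by move=> fu; left; apply: filt_mul_gl.
Qed.

Lemma tlift_tspan0 (W : lmodType k) (F : A -> A -> W) (R : A -> A -> Prop) t :
  bilinear F -> (forall u v, R u v -> F u v = 0) -> tspan R t -> tlift F t = 0.
Proof.
move=> bF RF; apply: linear_lspan0; first exact: tlift_linear.
by move=> _ [u [v [Ruv ->]]]; rewrite tlift_pure // RF.
Qed.

Local Notation unit := (conv_unit A B).
Local Notation "f ** g" := (conv B f g) (at level 40, left associativity).

Definition vanish n (f : A -> A) : Prop := forall x, filt n x -> f x = 0.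

Lemma vanish0 (f : {linear A -> A}) : (forall g, f (h g) = 0) -> vanish 0 f.
Proof.
move=> fh; apply: linear_lspan0 => [c x y|_ [g ->] //]; exact: linearP.
Qed.

Lemma vanish_conv n (f g : {linear A -> A}) : vanish n f -> vanish n (f ** g).
Proof.
move=> fn x /comul_filt_l; apply: tlift_tspan0; first exact: bilinear_conv.
by move=> u v /fn ->; rewrite mul0r.
Qed.

Lemma vanish_convS n (f g : {linear A -> A}) :
  vanish n f -> vanish 0 g -> vanish n.+1 (f ** g).
Proof.
move=> fn g0 x /comul_filt; apply: tlift_tspan0; first exact: bilinear_conv.
by move=> u v [/fn ->|/g0 ->]; rewrite ?mul0r ?mulr0.
Qed.

Lemma conv_gl (f f' : {linear A -> A}) g : (f ** f') (h g) = f (h g) * f' (h g).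
Proof. by rewrite /conv gl_comul tlift_pure //; apply: bilinear_conv. Qed.

Lemma unit_gl g : unit (h g) = 1.
Proof. by rewrite /conv_unit gl_counit scale1r. Qed.

Lemma convDl (f f' g : {linear A -> A}) x :
  ((f \+ f') ** g) x = (f ** g) x + (f' ** g) x.
Proof.
rewrite /conv; move: (comul B x); apply: tensor_ext => [||u v].
- exact: (tlift_linear (bilinear_conv (f \+ f') g)).
- by apply: linear_fun_add; apply/tlift_linear/bilinear_conv.
by rewrite !tlift_pure ?mulrDl //; apply: bilinear_conv.
Qed.

Lemma convDr (f g g' : {linear A -> A}) x :
  (f ** (g \+ g')) x = (f ** g) x + (f ** g') x.
Proof.
rewrite /conv; move: (comul B x); apply: tensor_ext => [||u v].
- exact: (tlift_linear (bilinear_conv f (g \+ g'))).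
- by apply: linear_fun_add; apply/tlift_linear/bilinear_conv.
by rewrite !tlift_pure ?mulrDr //; apply: bilinear_conv.
Qed.

Lemma convBl (f f' g : {linear A -> A}) x :
  ((f \- f') ** g) x = (f ** g) x - (f' ** g) x.
Proof.
apply/eqP; rewrite eq_sym subr_eq -convDl; apply/eqP.
by apply: eq_conv => // y; rewrite /= subrK.
Qed.

Lemma convBr (f g g' : {linear A -> A}) x :
  (f ** (g \- g')) x = (f ** g) x - (f ** g') x.
Proof.
apply/eqP; rewrite eq_sym subr_eq -convDr; apply/eqP.
by apply: eq_conv => // y; rewrite /= subrK.
Qed.

Section Inverse.
Variable e : {linear A -> A}.
Hypothesis eh : forall g, e (h g) = h g^-1%g.

(** An iteration towards a left convolution inverse of the identity: the defect
    at the next stage is the product of the defect with that of e, so that it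
    vanishes one step further along the filtration. *)
Fixpoint approx (n : nat) : {linear A -> A} :=
  if n is m.+1 then approx m \+ ((unit \- (approx m ** idfun)) ** e) else e.

Definition defect n : {linear A -> A} := unit \- (approx n ** idfun).

Lemma approxS n x : approx n.+1 x = approx n x + (defect n ** e) x.
Proof. by []. Qed.

Lemma defect0 : vanish 0 (defect 0).
Proof.
by apply: vanish0 => g; rewrite /= unit_gl conv_gl eh /= gl_mulVl subrr.
Qed.

Lemma defectS n : defect n.+1 =1 defect n ** defect 0.
Proof.
by move=> x; rewrite convBr conv1r /= convDl opprD addrA -convA.
Qed.

Lemma vanish_defect n : vanish n (defect n).
Proof.
elim: n => [|n IH]; first exact: defect0.
by move=> x fx; rewrite defectS; apply: vanish_convS IH defect0 x fx.
Qed.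

Lemma approx_stable m n x : (m <= n)%N -> filt m x -> approx n x = approx m x.
Proof.
move=> /subnK <-; elim: (n - m)%N => // d IH fx.
have fdx : filt (d + m) x by apply: filt_mono fx; rewrite leq_addl.
by rewrite addSn approxS (vanish_conv _ (@vanish_defect _)) // addr0 IH.
Qed.

Hypothesis gen : skew_generated.

Lemma conv_left_inverse : exists L : {linear A -> A}, L ** idfun =1 unit.
Proof.
have [N fN] := choice (filt_exhaustive gen).
(* The iterates become stationary at each x, and L is their limit. *)
pose L x := approx (N x) x.
have LE n x : filt n x -> L x = approx n x.
  move=> fx; rewrite /L; case/orP: (leq_total (N x) n) => le.
    by rewrite (approx_stable le).
  by rewrite (approx_stable le).
have lL : linear L.
  move=> c x y; pose n := maxn (N x) (N y).
  have fx : filt n x by apply: filt_mono (fN x); rewrite leq_maxl.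
  have fy : filt n y by apply: filt_mono (fN y); rewrite leq_maxr.
  by rewrite (LE _ _ fx) (LE _ _ fy) (LE n) ?linearP //; apply: filtD.
have [L' EL] := linear_funP lL; exists L' => x; have fx := fN x.
have vL : vanish (N x) (L' \- approx (N x)).
  by move=> y fy; rewrite /= -EL (LE _ _ fy) subrr.
have := vanish_conv idfun vL fx; rewrite convBl => /eqP; rewrite subr_eq0 => /eqP ->.
by apply/esym/eqP; rewrite -subr_eq0; apply/eqP/(vanish_defect fx).
Qed.

(** A left inverse L of the identity is two-sided: the defect 1 - id * L is
    idempotent, so that vanishing on the grouplikes propagates up the
    filtration. *)
Lemma conv_left_inverseP (L : {linear A -> A}) :
  L ** idfun =1 unit -> idfun ** L =1 unit.
Proof.
move=> LP; pose u : {linear A -> A} := unit \- (idfun ** L).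
have uu : u =1 u ** u.
  have Eu : (idfun ** L) ** (idfun ** L) =1 idfun ** L.
    move=> x; rewrite -convA; apply: eq_conv => // y.
    rewrite /= convA -[RHS](conv1l B); exact: eq_conv.
  by move=> x; rewrite convBr conv1r [(u ** (_ ** _)) x]convBl conv1l Eu subrr subr0.
have v0 : vanish 0 u.
  apply: vanish0 => g; rewrite /= unit_gl conv_gl /=.
  have := LP (h g); rewrite conv_gl unit_gl /= => LK.
  have -> : L (h g) = h g^-1%g.
    by rewrite -[LHS]mulr1 -(gl_mulV g) mulrA LK mul1r.
  by rewrite gl_mulV subrr.
have vu n : vanish n u.
  by elim: n => [//|n IH] x fx; rewrite uu; exact: (vanish_convS IH v0 fx).
by move=> x; have [n /vu/eqP] := filt_exhaustive gen x; rewrite subr_eq0 => /eqP.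
Qed.

End Inverse.

(** Takeuchi's criterion: a pointed bialgebra whose grouplikes are invertible is
    a Hopf algebra, here for one generated by grouplikes and skew-primitives. *)
Lemma antipode_exists : skew_generated ->
  (exists e : {linear A -> A}, forall g, e (h g) = h g^-1%g) ->
  exists S : {linear A -> A}, antipode B S.
Proof.
move=> gen [e eh]; have [L LP] := conv_left_inverse eh gen.
by exists L; split=> x; [exact: LP | exact: (conv_left_inverseP gen LP)].
Qed.

End PointedAntipode.

(** * Transport along surjective bialgebra morphisms *)

Section Morphisms.
Variables (k : fieldType) (G : groupType) (D A : algType k).
Variables (BD : bialgebra D) (BA : bialgebra A) (pr : {lrmorphism D -> A}).
Hypothesis prP : bialg_morphism BD BA pr.

Let lpr : linear pr. Proof. exact: linearP. Qed.

Lemma grouplike_map_morph (h : G -> D) :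
  grouplike_map BD h -> grouplike_map BA (pr \o h).
Proof.
have [prD prE] := prP; case=> h1 hM hG; split=> [|x y|x] /=.
- by rewrite h1 rmorph1.
- by rewrite hM rmorphM.
- have [hD hE] := hG x; split; last by rewrite prE.
  by rewrite prD hD tmap_pure.
Qed.

Lemma skew_primitive_morph (h : G -> D) x :
  skew_primitive BD h x -> skew_primitive BA (pr \o h) (pr x).
Proof.
have [prD _] := prP; move=> [g [g' xE]]; exists g, g'.
by rewrite prD xE (linear_funD _ _ (tmap_linear lpr lpr)) !tmap_pure.
Qed.

Lemma skew_generated_morph (h : G -> D) : (forall a, exists x, pr x = a) ->
  skew_generated BD h -> skew_generated BA (pr \o h).
Proof.
move=> surj gen Q Q1 QD Qg Qs a; have [x <-] := surj a.
move: x; apply: gen => [|c x y Qx Qy|x g Qx|x y Qx sy].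
- by rewrite rmorph1.
- by rewrite linearP; apply: QD.
- by rewrite rmorphM; apply: Qg.
- by rewrite rmorphM; apply: Qs => //; apply: skew_primitive_morph.
Qed.

(** Both sides are convolution inverses of the projection. *)
Lemma antipode_morph (SD : {linear D -> D}) (S : {linear A -> A}) :
  antipode BD SD -> antipode BA S -> forall x, pr (SD x) = S (pr x).
Proof.
have [prD prE] := prP; move=> [_ SDr] [Sl _] x.
symmetry; move: x.
apply: (@conv_inverse_unique _ _ _ BD (S \o pr) pr (pr \o SD)) => x.
  have := Sl (pr x); rewrite prE prD tlift_tmap //.
  by apply: bilinear_mul => //; apply: linearP.
rewrite /conv_unit -[1](rmorph1 pr) -linearZ /= -(SDr x) linear_tlift //.
- by congr (tlift _ _); apply/funext => y; apply/funext => z; rewrite rmorphM.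
- by apply: bilinear_mul => //; apply: linearP.
Qed.

Lemma linear_factor (W : lmodType k) (F : D -> W) : linear F ->
  (forall a, exists x, pr x = a) -> (forall x, pr x = 0 -> F x = 0) ->
  exists f : {linear A -> W}, forall x, f (pr x) = F x.
Proof.
move=> lF surj F0; have [s sK] := choice surj.
have FE x y : pr x = pr y -> F x = F y.
  move=> e; apply/eqP; rewrite -subr_eq0 addrC -scaleN1r -lF; apply/eqP/F0.
  by rewrite linearP /= e scaleN1r addNr.
have lf : linear (fun a => F (s a)).
  by move=> c a b /=; rewrite -lF; apply: FE; rewrite linearP /= !sK.
by have [f fE] := linear_funP lf; exists f => x; rewrite -fE; apply: FE.
Qed.

End Morphisms.

(** * Values of counit and antipode on skew-primitives *)

Section Primitive.
Variables (k : fieldType) (G : groupType) (A : algType k) (B : bialgebra A).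
Variable h : G -> A.
Hypothesis hP : grouplike_map B h.

Lemma counit_skew_primitive x : skew_primitive B h x -> counit B x = 0.
Proof.
move=> [g [g' xE]]; have := counitl B x; have bE : bilinear
    (fun u v : A => counit B u *: v).
  split=> [u|v] c y z; first by rewrite scalerDr !scalerA mulrC.
  by rewrite linearP scalerDl -scalerA.
rewrite xE (linear_funD _ _ (tlift_linear bE)) !tlift_pure // (gl_counit hP).
rewrite scale1r => /eqP; rewrite -subr_eq0 addrK => /eqP.
move=> /(congr1 (fun y => y * h g^-1%g)).
rewrite mul0r -scalerAl (gl_mulV hP) => /(congr1 (counit B)).
by rewrite linearZ /= rmorph1 linear0; apply: etrans; rewrite /GRing.scale /= mulr1.
Qed.

Variable S : {linear A -> A}.
Hypothesis SP : antipode B S.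

Let bS : bilinear (fun x y => S x * y).
Proof. by apply: bilinear_mul => //; apply: linearP. Qed.

Lemma antipode_gl g : S (h g) = h g^-1%g.
Proof.
have := SP.1 (h g); rewrite (gl_comul hP) tlift_pure // (gl_counit hP) scale1r => e.
by rewrite -[LHS]mulr1 -(gl_mulV hP g) mulrA e mul1r.
Qed.

Lemma antipode_skew g g' x : comul B x = x ⊗ h g + h g' ⊗ x ->
  S x = - (h g'^-1%g * x * h g^-1%g).
Proof.
move=> xE; have := SP.1 x; rewrite counit_skew_primitive; last by exists g, g'.
rewrite scale0r xE (linear_funD _ _ (tlift_linear bS)) !tlift_pure // antipode_gl.
move=> /eqP; rewrite addr_eq0 => /eqP e.
by rewrite -[LHS]mulr1 -(gl_mulV hP g) mulrA e mulNr.
Qed.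

End Primitive.

(** * Free algebras *)

Section FreeAlgebra.
Variables (k : fieldType) (X : choiceType).

Definition fword (m : {fmonom X}) : falg k X := << m >>.

Lemma falg_ext (W : lmodType k) (F F' : falg k X -> W) :
  linear F -> linear F' -> (forall m, F (fword m) = F' (fword m)) -> F =1 F'.
Proof.
move=> lF lF' FE; elim/malg_lin_ind => [|c m p IH].
  exact: etrans (linear_fun0 lF) (esym (linear_fun0 lF')).
apply: etrans (lF c (fword m) p) _; rewrite FE IH.
exact: esym (lF' c (fword m) p).
Qed.

Lemma fwordM m m' : fword m * fword m' = fword (mmul m m').
Proof. by rewrite /fword malgM_def fgmulUU mulr1. Qed.

Variables (A : algType k) (f : X -> A).

Lemma feval_linear : linear (feval f).
Proof. exact: lext_is_linear. Qed.

Lemma fevalB p q : feval f (p - q) = feval f p - feval f q.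
Proof. by rewrite addrC -scaleN1r feval_linear scaleN1r addrC. Qed.

Lemma feval_word m : feval f (fword m) = \prod_(x <- m) f x.
Proof. exact: lextU. Qed.

Lemma feval_gen x : feval f (fgen k x) = f x.
Proof. by rewrite [LHS]feval_word fmuE big_seq1. Qed.

Lemma feval1 : feval f 1 = 1.
Proof. by rewrite [LHS]feval_word fm1 big_nil. Qed.

Lemma fevalM p q : feval f (p * q) = feval f p * feval f q.
Proof.
have [bl br] : bilinear (fun p q => feval f p * feval f q).
  exact: bilinear_mul feval_linear feval_linear.
move: p; apply: (falg_ext _ (br q)) => [c x y|m].
  by rewrite mulrDl -scalerAl feval_linear.
move: q; apply: (falg_ext _ (bl _)) => [c x y|m'].
  by rewrite mulrDr -scalerAr feval_linear.
by rewrite fwordM !feval_word fmM big_cat.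
Qed.

Lemma feval_gen2 x y : feval f (fgen k x * fgen k y) = f x * f y.
Proof. exact: etrans (fevalM _ _) (congr2 *%R (feval_gen x) (feval_gen y)). Qed.

Lemma feval_comm x y z w :
  feval f (fgen k x * fgen k y - fgen k z * fgen k w) = 0 ->
  f x * f y = f z * f w.
Proof.
move=> /(etrans (esym (fevalB _ _))) /subr0_eq e.
exact: etrans (esym (feval_gen2 x y)) (etrans e (feval_gen2 z w)).
Qed.

Lemma feval_commutator x y z :
  feval f (fgen k x * fgen k y - fgen k y * fgen k x - fgen k z) = 0 ->
  f z = f x * f y - f y * f x.
Proof.
move=> /(etrans (esym (fevalB _ _))) /subr0_eq /esym e.
rewrite -[LHS]feval_gen; apply: etrans e (etrans (fevalB _ _) _).
by congr (_ - _); apply: feval_gen2.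
Qed.

End FreeAlgebra.

(** * The group algebra *)

Section GroupAlgebra.
Variables (k : fieldType) (G : groupType).

Lemma geltM (x y : G) : gelt x * gelt y = gelt (x * y)%g :> galg k G.
Proof. exact: gmul_elt. Qed.

Lemma gelt_inj : injective (@gelt k G).
Proof.
move=> x y /(congr1 (fun p : {malg k[G]} => p@_y)); rewrite !mcoeffU eqxx.
by case: eqP => // _ /eqP; rewrite eq_sym oner_eq0.
Qed.

Lemma gcomul_gelt (x : G) : gcomul (gelt x : galg k G) = gelt x ⊗ gelt x.
Proof. exact: lextU. Qed.

Lemma gcounit_gelt (x : G) : gcounit (gelt x : galg k G) = 1.
Proof. exact: lextU. Qed.

Lemma gantipode_gelt (x : G) : gantipode (gelt x : galg k G) = gelt x^-1%g.
Proof. exact: lextU. Qed.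

Lemma gcomul_linear : linear (@gcomul k G).
Proof. exact: lext_is_linear. Qed.

Lemma gcounit_linear : linear (@gcounit k G).
Proof. exact: lext_is_linear. Qed.

Lemma gantipode_linear : linear (@gantipode k G).
Proof. exact: lext_is_linear. Qed.

End GroupAlgebra.

(** * Augmentation of the tensor algebra *)

Section Augmentation.
Variables (k : fieldType) (V : vectType k).

Lemma tens_lift_in (A : algType k) (f : V -> A) v : linear f ->
  tens_lift f (tens_in v) = f v.
Proof.
move=> lf; rewrite /tens_lift (linear_fun_sum _ _ (feval_linear _)).
rewrite [in RHS](coord_vbasis (memvf v)) (linear_fun_sum _ _ lf).
apply: eq_bigr => i _.
by rewrite (linear_funZ _ _ (feval_linear _)) feval_gen (linear_funZ _ _ lf).
Qed.

Definition tens_aug : tens V -> k^o := tens_lift (fun=> 0).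

Lemma tens_aug_linear : linear tens_aug.
Proof. exact: feval_linear. Qed.

Lemma tens_aug1 : tens_aug 1 = 1.
Proof. exact: feval1. Qed.

Lemma tens_aug_gt1 x : tens_gt1 x -> tens_aug x = 0.
Proof.
move: x; apply: linear_lspan0; first exact: tens_aug_linear.
move=> x [n n1]; move: x; apply: linear_lspan0; first exact: tens_aug_linear.
move=> _ [s + ->]; case: s => [|v s] sn; first by rewrite -sn in n1.
rewrite /tens_prod big_cons /tens_aug /tens_lift fevalM.
rewrite [feval _ (tens_in v)](_ : _ = 0) ?mul0r //.
by apply: (@tens_lift_in _ (fun=> 0)) => c y z; rewrite scaler0 addr0.
Qed.

End Augmentation.

(** * Free braided doubles *)

Section FreeDouble.
Variables (k : fieldType) (G : groupType) (b : braided_data k G).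
Local Notation kG := (galg k G).
Local Notation V := (bd_V b).
Local Notation W := (bd_W b).
Local Notation D := (bd_alg b).
Local Notation h g := (bd_h b (gelt g)).

Lemma bd_mulV1 : bd_mulV (1 : tens V) = 1.
Proof. exact: feval1. Qed.

Lemma bd_mulW1 : bd_mulW (1 : tens W) = 1.
Proof. exact: feval1. Qed.

Fact bd_bilinearVH : bilinear (fun (x : tens V) (y : kG) => bd_mulV x * bd_h b y).
Proof.
by apply: bilinear_mul => [|c x y]; [exact: feval_linear | rewrite linearP].
Qed.

Fact bd_bilinearVHW : bilinear (fun t (y : tens W) =>
  tlift (fun (x : tens V) (h : kG) => bd_mulV x * bd_h b h) t * bd_mulW y).
Proof.
apply: bilinear_mul; last exact: feval_linear.
exact: tlift_linear bd_bilinearVH.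
Qed.

Lemma bd_mul_linear : linear (@bd_mul k G b).
Proof. exact: tlift_linear bd_bilinearVHW. Qed.

Lemma bd_mul_pure x y z :
  bd_mul ((x ⊗ y) ⊗ z) = bd_mulV x * bd_h b y * bd_mulW z.
Proof.
by rewrite /bd_mul (tlift_pure bd_bilinearVHW) (tlift_pure bd_bilinearVH).
Qed.

Hypothesis freeb : free_braided_double b.

Lemma bd_relation0 r : bd_relation r -> feval (@bd_gen k G b) r = 0.
Proof.
have [[_ _ [_ relP]] _] := freeb => rr; apply/relP/lspan_gen.
by exists 1, r, 1; rewrite mul1r mulr1.
Qed.

Lemma bd_commWH f g : bd_f b f * h g = h g * bd_f b (bd_ract f g).
Proof. exact: feval_comm (bd_relation0 (RelWH f g)). Qed.

Lemma bd_commHV g v : h g * bd_v b v = bd_v b (bd_act g v) * h g.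
Proof. exact: feval_comm (bd_relation0 (RelHV g v)). Qed.

Lemma bd_commWV f v :
  bd_h b (bd_beta f v) = bd_f b f * bd_v b v - bd_v b v * bd_f b f.
Proof. exact: feval_commutator (bd_relation0 (RelWV f v)). Qed.

(** The triangular decomposition retracts the double onto the group algebra. *)
Lemma bd_retraction : exists rho : {linear D -> kG}, forall x y z,
  rho (bd_mulV x * bd_h b y * bd_mulW z) = tens_aug z *: (tens_aug x *: y).
Proof.
have [_ [inv mulK invK]] := freeb.
have [m mE] := linear_funP bd_mul_linear.
have linv : linear inv.
  by apply: (@can2_linear _ _ _ m); rewrite -mE.
have bR : bilinear (fun (x : tens V) (y : kG) => tens_aug x *: y).
  split=> [x|y] c u v; first by rewrite scalerDr !scalerA mulrC.
  by rewrite tens_aug_linear scalerDl -scalerA.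
have bR' : bilinear (fun t (z : tens W) =>
    tens_aug z *: tlift (fun (x : tens V) (y : kG) => tens_aug x *: y) t).
  split=> [t|z] c u v; first by rewrite tens_aug_linear scalerDl -scalerA.
  by rewrite (tlift_linear bR) scalerDr !scalerA mulrC.
have [rho rhoE] := linear_funP (linear_comp (tlift_linear bR') linv).
by exists rho => x y z; rewrite -rhoE -bd_mul_pure mulK !tlift_pure.
Qed.

Lemma bd_h_inj : injective (bd_h b).
Proof.
have [rho rhoE] := bd_retraction; suff K y : rho (bd_h b y) = y.
  by move=> x y /(congr1 rho); rewrite !K.
have := rhoE 1 y 1.
by rewrite bd_mulV1 bd_mulW1 mul1r mulr1 !tens_aug1 !scale1r.
Qed.

Lemma bd_gl_inverse : exists e : {linear D -> D},
  (forall g, e (h g) = h g^-1%g) /\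
  forall I I', (forall x, I x -> tens_gt1 x) -> (forall y, I' y -> tens_gt1 y) ->
    forall z, tri_sub I I' z -> e z = 0.
Proof.
have [rho rhoE] := bd_retraction.
have [e eE] : exists e : {linear D -> D}, (fun x => bd_h b (gantipode (rho x))) = e.
  apply: linear_funP => c x y; rewrite linearP gantipode_linear.
  exact: linearP.
exists e; rewrite -eE; split=> [g|I I' I1 I1'].
  have := rhoE 1 (gelt g) 1; rewrite bd_mulV1 bd_mulW1 mul1r mulr1 => ->.
  by rewrite !tens_aug1 !scale1r gantipode_gelt.
apply: linear_lspan0 => [|_ [x [y [z [xz ->]]]]].
  by rewrite eE => c x y; rewrite linearP.
rewrite rhoE; case: xz => [/I1|/I1'] /tens_aug_gt1 ->;
  by rewrite ?scale0r ?scaler0 (linear_fun0 (@gantipode_linear k G)) linear0.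
Qed.

End FreeDouble.

(** * Diagonal Yetter--Drinfeld modules and pairings *)

Section Bases.
Variables (k : fieldType) (V : vectType k) (n : nat) (e : n.-tuple V).
Hypothesis eP : basis_of fullv e.

Lemma coord_tnth i j : coord e i (tnth e j) = (i == j)%:R.
Proof.
by rewrite (tnth_nth 0) coord_free ?(basis_free eP) // eq_sym.
Qed.

Lemma coord_expand v : v = \sum_i coord e i v *: tnth e i.
Proof.
rewrite [LHS](coord_basis eP (memvf v)).
by apply: eq_bigr => i _; rewrite (tnth_nth 0).
Qed.

Lemma basis_closed (P : V -> Prop) :
  P 0 -> (forall c x y, P x -> P y -> P (c *: x + y)) ->
  (forall i, P (tnth e i)) -> forall v, P v.
Proof.
move=> P0 PD Pe v; rewrite [v]coord_expand; elim: (index_enum _) => [|i r IH].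
  by rewrite big_nil.
by rewrite big_cons; apply: PD.
Qed.

Lemma basis_ext (W : lmodType k) (F F' : V -> W) : linear F -> linear F' ->
  (forall i, F (tnth e i) = F' (tnth e i)) -> F =1 F'.
Proof.
move=> lF lF' FE; apply: basis_closed => // [|c x y Fx Fy].
  by rewrite !linear_fun0.
by rewrite lF lF' Fx Fy.
Qed.

Definition basis_map (W : lmodType k) (w : 'I_n -> W) (v : V) : W :=
  \sum_i coord e i v *: w i.

Lemma basis_map_linear (W : lmodType k) (w : 'I_n -> W) : linear (basis_map w).
Proof.
move=> c x y; rewrite /basis_map scaler_sumr -big_split; apply: eq_bigr => i _.
by rewrite linearP scalerDl scalerA.
Qed.

Lemma basis_map_tnth (W : lmodType k) (w : 'I_n -> W) i :
  basis_map w (tnth e i) = w i.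
Proof.
rewrite /basis_map (bigD1 i) //= coord_tnth eqxx scale1r big1 ?addr0 // => j.
by move=> /negPf ji; rewrite coord_tnth ji scale0r.
Qed.

End Bases.

Section DiagonalCoaction.
Variables (k : fieldType) (G : groupType) (V : vectType k) (n : nat).
Variables (e : n.-tuple V) (gr : 'I_n -> G).
Local Notation kG := (galg k G).

(** The coaction of a G-grading of V for which the basis e is homogeneous. *)
Definition diag_coact : V -> kG ⊗ V :=
  basis_map e (fun i => gelt (gr i) ⊗ tnth e i).

Hypothesis eP : basis_of fullv e.

Lemma diag_coact_linear : linear diag_coact.
Proof. exact: basis_map_linear. Qed.

Lemma diag_coact_tnth i : diag_coact (tnth e i) = gelt (gr i) ⊗ tnth e i.
Proof. exact: basis_map_tnth. Qed.

Lemma diag_yetter_drinfeld (act : G -> V -> V) (chi : 'I_n -> G -> k) :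
  is_rep act -> (forall i g, act g (tnth e i) = chi i g *: tnth e i) ->
  (forall i g, commute g (gr i)) -> yetter_drinfeld act diag_coact.
Proof.
move=> rep actE comm; have [lact _ _] := rep.
have lid (U : lmodType k) : linear (@id U) by [].
have lco := diag_coact_linear.
have lcomul := @gcomul_linear k G.
have lmul g : linear (fun h : kG => gelt g * h).
  by move=> c x y; rewrite mulrDr scalerAr.
have lmulr g : linear (fun h : kG => h * gelt g).
  by move=> c x y; rewrite mulrDl scalerAl.
split; [exact: rep | exact: lco | move=> v | move=> v | move=> g v];
  move: v; apply: (basis_ext eP).
- exact: linear_comp (@tassoc_linear _ _ _ _) (linear_comp (tmap_linear _ _) _).
- exact: linear_comp (tmap_linear _ _) _.
- move=> i; rewrite diag_coact_tnth !tmap_pure // gcomul_gelt tassoc_pure.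
  by rewrite diag_coact_tnth.
- apply: linear_comp lco; apply: tlift_linear; split=> [x|x] c u v.
    by rewrite scalerDr !scalerA mulrC.
  by rewrite gcounit_linear scalerDl -scalerA.
- by [].
- move=> i; rewrite diag_coact_tnth tlift_pure ?gcounit_gelt ?scale1r //.
  split=> [x|x] c u v; first by rewrite scalerDr !scalerA mulrC.
  by rewrite gcounit_linear scalerDl -scalerA.
- exact: linear_comp (tmap_linear _ _) _.
- exact: linear_comp (linear_comp (tmap_linear _ _) _) _.
move=> i; rewrite actE (linear_funZ _ _ lco) diag_coact_tnth.
rewrite (linear_funZ _ _ (tmap_linear (lmulr g) (lid V))) !tmap_pure // !geltM.
by rewrite actE (linear_funZ _ _ ((tpure_bilinear _ _).1 _)) comm.
Qed.

End DiagonalCoaction.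

Section DiagonalPairing.
Variables (k : fieldType) (V W : vectType k) (n : nat).
Variables (e : n.-tuple V) (f : n.-tuple W) (c : 'I_n -> k).

Definition diag_pair (w : W) (v : V) : k^o :=
  \sum_i c i * coord f i w * coord e i v.

Lemma diag_pair_bilinear : bilinear diag_pair.
Proof.
split=> [w|v] a x y; rewrite /diag_pair scaler_sumr -big_split;
  apply: eq_bigr => i _; rewrite linearP /= /GRing.scale /=.
- by rewrite mulrDr mulrCA.
- by rewrite mulrDr mulrDl mulrCA !mulrA.
Qed.

Hypotheses (eP : basis_of fullv e) (fP : basis_of fullv f).

Lemma diag_pair_tnthr w i : diag_pair w (tnth e i) = c i * coord f i w.
Proof.
rewrite /diag_pair (bigD1 i) //= coord_tnth // eqxx mulr1 big1 ?addr0 // => j.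
by move=> /negPf ji; rewrite coord_tnth // ji mulr0.
Qed.

Lemma diag_pair_tnthl i v : diag_pair (tnth f i) v = c i * coord e i v.
Proof.
rewrite /diag_pair (bigD1 i) //= coord_tnth // eqxx mulr1 big1 ?addr0 // => j.
by move=> /negPf ji; rewrite coord_tnth // ji mulr0 mul0r.
Qed.

Lemma diag_pair_perfect : (forall i, c i != 0) -> perfect_pairing diag_pair.
Proof.
move=> c0; split=> [|w wE|v vE]; first exact: diag_pair_bilinear.
  rewrite (coord_expand fP w) big1 // => i _; apply/eqP; rewrite scaler_eq0.
  have /eqP := wE (tnth e i).
  by rewrite diag_pair_tnthr mulf_eq0 (negPf (c0 i)) /= => ->.
rewrite (coord_expand eP v) big1 // => i _; apply/eqP; rewrite scaler_eq0.
have /eqP := vE (tnth f i).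
by rewrite diag_pair_tnthl mulf_eq0 (negPf (c0 i)) /= => ->.
Qed.

End DiagonalPairing.

Section DualRepresentation.
Variables (k : fieldType) (G : groupType) (V W : vectType k).
Variables (act : G -> V -> V) (ract : W -> G -> W) (pair : W -> V -> k^o).
Hypothesis dual : dual_rep act ract pair.

Lemma pair_inj f f' : (forall v, pair f v = pair f' v) -> f = f'.
Proof.
have [_ [[_ br] inj _] _] := dual => fE; apply/eqP; rewrite -subr_eq0; apply/eqP.
apply: inj => v; rewrite addrC -scaleN1r (br v) fE scaleN1r addNr //.
Qed.

Lemma dual_ract_linear g : linear (ract^~ g).
Proof.
have [_ [[_ br] _ _] ractE] := dual => c f f'; apply: pair_inj => v.
by rewrite (br v) !ractE (br _).
Qed.

Lemma dual_is_rep : is_rep (fun g f => ract f g^-1%g).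
Proof.
have [[_ act1 actM] _ ractE] := dual; split=> [g|f|g h f].
- exact: dual_ract_linear.
- by apply: pair_inj => v; rewrite ractE invg1 act1.
- by apply: pair_inj => v; rewrite !ractE invgM actM.
Qed.

End DualRepresentation.

(** * From the normal form to an asymmetric double *)

Section ChangeOfPairing.
Variables (k : fieldType) (G : groupType) (b : braided_data k G).

Definition change_pairing (pair : bd_W b -> bd_V b -> k^o)
    (beta : bd_W b -> bd_V b -> galg k G) : braided_data k G :=
  BraidedData pair (@bd_act _ _ b) (@bd_ract _ _ b) beta
    (bd_v b) (bd_h b) (bd_f b).

(** The pairing enters the defining relations of a braided double only through
    the commutators, so it can be changed as long as these are kept. *)
Lemma free_change_pairing pair beta :
  dual_rep (@bd_act _ _ b) (@bd_ract _ _ b) pair -> @bd_beta _ _ b = beta ->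
  free_braided_double b -> free_braided_double (change_pairing pair beta).
Proof.
move=> dual <- [[_ bb [surj rel]] bij]; split=> //; split=> //; split=> // p.
set b' := change_pairing _ _ in p *.
suff <- : @bd_relation _ _ b = @bd_relation _ _ b' by exact: rel.
apply/funext => r; apply/propext; split; case.
- exact: (@RelLinV _ _ b').
- exact: (@RelLinH _ _ b').
- exact: (@RelLinW _ _ b').
- exact: (@RelOneH _ _ b').
- exact: (@RelMulH _ _ b').
- exact: (@RelWH _ _ b').
- exact: (@RelHV _ _ b').
- exact: (@RelWV _ _ b').
- exact: (@RelLinV _ _ b).
- exact: (@RelLinH _ _ b).
- exact: (@RelLinW _ _ b).
- exact: (@RelOneH _ _ b).
- exact: (@RelMulH _ _ b).
- exact: (@RelWH _ _ b).
- exact: (@RelHV _ _ b).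
- exact: (@RelWV _ _ b).
Qed.

Lemma hopf_ideal_change_pairing pair beta (B : bialgebra (bd_alg b)) I I' :
  @triangular_hopf_ideal _ _ b B I I' ->
  @triangular_hopf_ideal _ _ (change_pairing pair beta) B I I'.
Proof. by case=> -[*]; split. Qed.

End ChangeOfPairing.

Lemma ad_beta_bilinear (k : fieldType) (G : groupType) (a : asymmetric_data k G) :
  bilinear (@ad_pair _ _ a) -> linear (@ad_coactV _ _ a) ->
  linear (@ad_coactW _ _ a) -> bilinear (@ad_beta _ _ a).
Proof.
move=> [bl br] lV lW.
have b1 f : bilinear (fun (h : galg k G) (v0 : ad_V a) =>
    ad_pair f v0 *: gantipode h).
  split=> [h|v] c x y; first by rewrite bl scalerDl -scalerA.
  by rewrite gantipode_linear scalerDr !scalerA mulrC.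
have b2 v : bilinear (fun (h : galg k G) (f0 : ad_W a) => ad_pair f0 v *: h).
  split=> [h|f] c x y; first by rewrite (br v) scalerDl -scalerA.
  by rewrite scalerDr !scalerA mulrC.
have lN (U U' : lmodType k) (F : U -> U') : linear F -> linear (fun x => - F x).
  by move=> lF c x y; rewrite lF opprD scalerN.
split=> [f|v]; apply: linear_fun_add.
- exact: linear_comp (tlift_linear (b1 f)) lV.
- apply: lN; apply: tlift_param => // h f0; move=> c x y.
  by rewrite bl scalerDl -scalerA.
- apply: tlift_param => // h v0 c x y.
  by rewrite (br v0) scalerDl -scalerA.
- by apply: lN; apply: linear_comp (tlift_linear (b2 v)) lW.
Qed.

Lemma commute_subgroup_gen (G : groupType) (S : G -> Prop) x :
  (forall s, S s -> commute x s) -> forall y, subgroup_gen S y -> commute x y.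
Proof.
move=> xS y; elim=> [|s z Ss _ xz|s z Ss _ xz]; first exact: commute1.
  by apply: commuteM xz; apply: xS.
by apply: commuteM xz; apply/commuteV/xS.
Qed.

Lemma act_alg_bilinear (k : fieldType) (G : groupType) (V : lmodType k)
    (act : G -> V -> V) : (forall g, linear (act g)) -> bilinear (act_alg act).
Proof.
move=> lact; split=> [y|x]; last exact: lext_is_linear.
move=> c x x'; elim/galg_ind: y => [|d g y IH]; rewrite /act_alg.
  by rewrite !lext0 scaler0 addr0.
rewrite !lext_is_linear !lextU lact [lext _ y]IH !scalerDr !scalerA mulrC.
by rewrite -!addrA; congr (_ + _); rewrite addrCA.
Qed.

Section NormalForm.
Variables (k : fieldType) (G : groupType) (A : algType k) (B : bialgebra A).
Variable T : @triangular_decomposition k G A B.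
Local Notation b := (td_data T).
Local Notation V := (bd_V b).
Local Notation W := (bd_W b).
Local Notation D := (bd_alg b).
Local Notation BD := (td_bialg T).
Local Notation h g := (bd_h b (gelt g)).

Variables (n : nat) (v : n.-tuple V) (f : n.-tuple W).
Variables (K L : 'I_n -> G) (lam : 'I_n -> G -> k) (gam : 'I_n -> 'I_n -> k).
Hypothesis NF : normal_form v f K L lam gam.

Lemma lam_neq0 i g : lam i g != 0.
Proof.
apply/eqP => l0; have := nf_charM NF i g g^-1%g.
by rewrite mulgV (nf_char1 NF) l0 mul0r => /eqP; rewrite oner_eq0.
Qed.

Lemma lamV i g : lam i g^-1%g = (lam i g)^-1.
Proof.
apply: (mulfI (lam_neq0 i g)).
by rewrite -(nf_charM NF) mulgV (nf_char1 NF) divff // lam_neq0.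
Qed.

Lemma td_grouplike_map : grouplike_map BD (fun g => h g).
Proof.
have lh : linear (bd_h b) by exact: linearP.
split=> [|x y|x]; first exact: rmorph1.
  by rewrite -rmorphM geltM.
split; last by rewrite (tb_counitH (td_triangular T)) gcounit_gelt.
by rewrite (tb_comulH (td_triangular T)) gcomul_gelt tmap_pure.
Qed.

Let hP := td_grouplike_map.

Lemma comul_v i : let x := bd_v b (tnth v i) in
  comul BD x = x ⊗ h (K i) + h 1%g ⊗ x.
Proof. by rewrite /= (gl_one hP); apply: nf_comulV NF i. Qed.

Lemma comul_f i : let y := bd_f b (tnth f i) in
  comul BD y = y ⊗ h 1%g + h (L i) ⊗ y.
Proof. by rewrite /= (gl_one hP); apply: nf_comulW NF i. Qed.

Lemma td_skew_generated : skew_generated BD (fun g => h g).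
Proof.
move=> Q Q1 QD Qg Qs; have Q0 : Q 0 by rewrite -(addNr 1) -scaleN1r; apply: QD.
have [[_ _ [surj _]] _] := td_free T.
have Qgen x (y : bd_generators b) : Q x -> Q (x * bd_gen y).
  move=> Qx; case: y => [[w|y]|w] /=.
  - move: w; apply: (basis_closed (nf_basisV NF)) => [|c y z|i].
    + by rewrite linear0 mulr0.
    + by rewrite linearP mulrDr -scalerAr; apply: QD.
    + by apply: Qs => //; exists (K i), 1%g; apply: comul_v.
  - elim/galg_ind: y => [|c g y Qy]; first by rewrite linear0 mulr0.
    by rewrite linearP mulrDr -scalerAr; apply: QD => //; apply: Qg.
  - move: w; apply: (basis_closed (nf_basisW NF)) => [|c y z|i].
    + by rewrite linear0 mulr0.
    + by rewrite linearP mulrDr -scalerAr; apply: QD.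
    + by apply: Qs => //; exists 1%g, (L i); apply: comul_f.
move=> x; have [p <-] := surj x; elim/malg_lin_ind: p => [|c m p Qp].
  by rewrite (linear_fun0 (@feval_linear _ _ _ _)).
rewrite feval_linear; apply: QD => //; rewrite /feval lextU -[X in Q X]mul1r.
suff Qprod (s : seq (bd_generators b)) z : Q z -> Q (z * \prod_(y <- s) bd_gen y).
  exact: Qprod.
elim: s z => [|y s IH] z Qz; first by rewrite big_nil mulr1.
by rewrite big_cons mulrA; apply/IH/Qgen.
Qed.

(** Conjugation by g multiplies f i by the inverse of the scalar by which it
    multiplies v i, so the commutator of the two is invariant. *)
Lemma comm_beta i g :
  let z := bd_h b (bd_beta (tnth f i) (tnth v i)) in z * h g = h g * z.
Proof.
rewrite /= (bd_commWV (td_free T)); apply: (scalerI (lam_neq0 i g)).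
have fg : bd_f b (tnth f i) * h g = lam i g *: (h g * bd_f b (tnth f i)).
  by rewrite (bd_commWH (td_free T)) (nf_ract NF) linearZ /= scalerAr.
have gv : h g * bd_v b (tnth v i) = lam i g *: (bd_v b (tnth v i) * h g).
  by rewrite (bd_commHV (td_free T)) (nf_act NF) linearZ /= scalerAl.
rewrite mulrBl mulrBr !scalerBr; congr (_ - _).
  by rewrite -mulrA scalerAr -gv mulrA fg -scalerAl mulrA.
by rewrite -mulrA fg mulrA gv -scalerAr -scalerAl mulrA.
Qed.

Hypothesis gam0 : forall i, gam i i != 0.

Lemma comm_beta_gelt i g : (gelt (K i) - gelt (L i)) * gelt g =
  gelt g * (gelt (K i) - gelt (L i)) :> galg k G.
Proof.
apply: (bd_h_inj (td_free T)); apply: (scalerI (gam0 i)).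
have := comm_beta i g; rewrite /= (nf_beta NF) linearZ /= -scalerAl -scalerAr.
by rewrite !rmorphM.
Qed.

(** In the equation g (K i - L i) = (K i - L i) g one of the two terms cancels
    when g is a K j or an L j, as the K's commute with the L's; so the other term
    commutes with g. *)
Lemma normal_form_abelian (x y : G) : commute x y.
Proof.
have KK i j : commute (K j) (K i).
  have := comm_beta_gelt i (K j); rewrite mulrBl mulrBr !geltM (nf_comm NF).
  by move=> /addIr /gelt_inj.
have LL i j : commute (L j) (L i).
  have := comm_beta_gelt i (L j); rewrite mulrBl mulrBr !geltM -(nf_comm NF).
  by move=> /addrI /oppr_inj /gelt_inj.
apply: commute_subgroup_gen (nf_gen NF y) => s [i sE].
apply/commute_sym; apply: commute_subgroup_gen (nf_gen NF x) => t [j tE].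
case: sE tE => -> [] ->; [exact: KK | exact: nf_comm NF i j | | exact: LL].
exact/commute_sym/(nf_comm NF).
Qed.

Hypothesis lam_inj : injective lam.

Lemma gam_diag i j : gam i j = gam i i * (i == j)%:R.
Proof.
case: eqVneq => [->|ij]; first by rewrite mulr1.
by rewrite mulr0; apply: (nf_gam NF) => /lam_inj /eqP; apply/negP.
Qed.

Local Notation pairD := (diag_pair v f (fun i => gam i i)).

(** The degree of v i is inverted because the antipode enters the commutator and
    the coproduct of V; that of f i is not. *)
Definition double_data : asymmetric_data k G :=
  AsymmetricData pairD (@bd_act _ _ b) (@bd_ract _ _ b)
    (diag_coact v (fun i => (K i)^-1%g)) (diag_coact f L)
    (bd_v b) (bd_h b) (bd_f b).

Lemma dual_repD : dual_rep (@bd_act _ _ b) (@bd_ract _ _ b) pairD.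
Proof.
have [[dual _ _] _] := td_free T; have [rep _ _] := dual; have [lact _ _] := rep.
have [bl br] := diag_pair_bilinear v f (fun i => gam i i).
split=> //; first exact: diag_pair_perfect (nf_basisV NF) (nf_basisW NF) gam0.
move=> w g x; move: w; apply: (basis_ext (nf_basisW NF)) => [||i].
- exact: linear_comp (br x) (dual_ract_linear dual g).
- exact: br.
move: x; apply: (basis_ext (nf_basisV NF)) => [||j].
- exact: bl.
- exact: linear_comp (bl _) (lact g).
rewrite (nf_ract NF) (nf_act NF) (linear_funZ _ _ (bl _)) (linear_funZ _ _ (br _)).
rewrite (diag_pair_tnthl _ _ (nf_basisW NF)) (coord_tnth (nf_basisV NF)).
by case: eqVneq => [->//|_]; rewrite mulr0 !scaler0.
Qed.

Lemma ad_betaE : @bd_beta _ _ b = @ad_beta _ _ double_data.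
Proof.
have bp := diag_pair_bilinear v f (fun i => gam i i).
have [bl br] : bilinear (@ad_beta _ _ double_data).
  apply: ad_beta_bilinear => //; exact: diag_coact_linear.
have [[_ [bl' br'] _] _] := td_free T.
apply/funext => w; apply/funext; apply: (basis_ext (nf_basisV NF)) => // j.
move: w; apply: (basis_ext (nf_basisW NF)) => // i.
rewrite (nf_beta NF) gam_diag /ad_beta /= (diag_coact_tnth _ (nf_basisV NF)).
rewrite (diag_coact_tnth _ (nf_basisW NF)) !tlift_pure.
- rewrite gantipode_gelt invgK (diag_pair_tnthl _ _ (nf_basisW NF)).
  by rewrite (coord_tnth (nf_basisV NF)) scalerBr.
- split=> [x|x] c y z; first by rewrite (bp.2 _ c) scalerDl -scalerA.
  by rewrite scalerDr !scalerA mulrC.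
- split=> [x|x] c y z; first by rewrite bp.1 scalerDl -scalerA.
  by rewrite gantipode_linear scalerDr !scalerA mulrC.
Qed.

Lemma yetter_drinfeld_pairD : yetter_drinfeld_pair double_data.
Proof.
have [[dual _ _] _] := td_free T; have [rep _ _] := dual; have [lact _ _] := rep.
have vP := nf_basisV NF; have fP := nf_basisW NF.
split=> /=.
- exact: dual_repD.
- apply: (diag_yetter_drinfeld vP) (nf_act NF) _ => // i g.
  exact: normal_form_abelian.
- apply: (@diag_yetter_drinfeld _ _ _ _ _ _ fP _ (fun i g => lam i g^-1%g)).
  + exact: dual_is_rep dual.
  + by move=> i g; apply: nf_ract NF i _.
  + by move=> i g; apply: normal_form_abelian.
have lract : forall g, linear (fun w : W => bd_ract w g).
  exact: dual_ract_linear dual.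
have bact := act_alg_bilinear lact.
have bract := act_alg_bilinear lract.
have bF x : bilinear (fun (y : galg k G) (w : W) =>
    act_alg (@bd_act _ _ b) y x ⊗ w).
  by apply: bilinear_tpure => //; case: bact.
have bF' w : bilinear (fun (y : galg k G) (x : V) =>
    x ⊗ ract_alg (@bd_ract _ _ b) w y).
  split=> [y|x] c u u'; first exact: (tpure_bilinear V W).2.
  by rewrite [ract_alg _ _ _](bract.2 w) (tpure_bilinear V W).1.
move=> x w; move: x; apply: (basis_ext vP) => [||j].
- apply: tlift_param => // y u c x x'.
  by rewrite bact.1 ((tpure_bilinear V W).2 _ c).
- exact: linear_comp (tlift_linear (bF' w)) (diag_coact_linear _ _).
move: w; apply: (basis_ext fP) => [||i].
- exact: linear_comp (tlift_linear (bF _)) (diag_coact_linear _ _).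
- apply: tlift_param => // y u c w w'.
  by rewrite [ract_alg _ _ _](bract.1 y) (tpure_bilinear V W).1.
rewrite !diag_coact_tnth // (tlift_pure (bF _)) (tlift_pure (bF' _)).
rewrite /act_alg /ract_alg !lextU.
rewrite (nf_act NF) (nf_ract NF) lamV (nf_lamKL NF) invrK.
have [bl br] := tpure_bilinear V W.
by rewrite (linear_funZ _ _ (bl _)) (linear_funZ _ _ (br _)).
Qed.

Lemma free_braidedD : free_braided_double (ad_braided double_data).
Proof. exact: free_change_pairing dual_repD ad_betaE (td_free T). Qed.

Lemma asymmetric_hopfD (S : {linear D -> D}) : antipode BD S ->
  @asymmetric_hopf _ _ double_data BD S.
Proof.
move=> SP; have vP := nf_basisV NF; have fP := nf_basisW NF.
have lh : linear (bd_h b) by exact: linearP.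
have lv : linear (bd_v b) by exact: linearP.
have lf : linear (bd_f b) by exact: linearP.
have lco := diag_coact_linear v (fun i => (K i)^-1%g).
have lco' := diag_coact_linear f L.
have lant := @gantipode_linear k G.
have lS : linear S by exact: linearP.
have lD : linear (comul BD) by exact: linearP.
have [bl br] := tpure_bilinear D D.
have bv : bilinear (fun (y : galg k G) x => bd_v b x ⊗ bd_h b (gantipode y)).
  split=> [y|x] c u u'; first by rewrite lv (br _ c).
  by rewrite lant lh bl.
have bf : bilinear (fun (y : galg k G) w => bd_h b y ⊗ bd_f b w).
  exact: bilinear_tpure.
have bSv : bilinear (fun (y : galg k G) x => bd_v b x * bd_h b y).
  split=> [y|x] c u u'; first by rewrite lv mulrDl scalerAl.
  by rewrite lh mulrDr scalerAr.
have bSf : bilinear (fun (y : galg k G) w => bd_h b (gantipode y) * bd_f b w).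
  by apply: bilinear_mul lf; apply: linear_comp lh lant.
split=> //=.
- exact: tb_comulH (td_triangular T).
- apply: (basis_ext vP) => [||i]; first exact: linear_comp lD lv.
    apply: linear_fun_add; first exact: linear_comp (tlift_linear bv) lco.
    exact: linear_comp (bl 1) lv.
  by rewrite (nf_comulV NF) diag_coact_tnth // (tlift_pure bv) gantipode_gelt invgK.
- apply: (basis_ext fP) => [||i]; first exact: linear_comp lD lf.
    apply: linear_fun_add; first exact: linear_comp (br 1) lf.
    exact: linear_comp (tlift_linear bf) lco'.
  by rewrite (nf_comulW NF) diag_coact_tnth // tlift_pure.
- exact: tb_counitH (td_triangular T).
- apply: (basis_closed vP) => [|c x y ex ey|i]; first by rewrite !linear0.
    by rewrite !linearP /= ex ey scaler0 addr0.
  apply: (counit_skew_primitive hP); exists (K i), 1%g; exact: comul_v.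
- apply: (basis_closed fP) => [|c x y ex ey|i]; first by rewrite !linear0.
    by rewrite !linearP /= ex ey scaler0 addr0.
  apply: (counit_skew_primitive hP); exists 1%g, (L i); exact: comul_f.
- apply: (basis_ext vP) => [||i]; first exact: linear_comp lS lv.
    move=> c x y; rewrite lco (tlift_linear bSv) opprD scalerN //.
  rewrite (antipode_skew hP SP (comul_v i)) diag_coact_tnth // tlift_pure //.
  by rewrite invg1 (gl_one hP) mul1r.
apply: (basis_ext fP) => [||i]; first exact: linear_comp lS lf.
  by move=> c x y; rewrite lco' (tlift_linear bSf) opprD scalerN.
rewrite (antipode_skew hP SP (comul_f i)) diag_coact_tnth // tlift_pure //.
by rewrite invg1 (gl_one hP) mulr1 gantipode_gelt.
Qed.

Lemma normal_form_asymmetric : asymmetric_braided_double G B.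
Proof.
have [surj kerP] := td_quotient T.
have thi := td_hopf_ideal T; have tri := thi_triangular thi.
have gen := td_skew_generated.
have [e [eh eJ]] := bd_gl_inverse (td_free T).
have [S' S'P] : exists S' : {linear D -> D}, antipode BD S'.
  by apply: antipode_exists hP gen _; exists e.
have mor := td_morphism T.
have lpr : linear (td_proj T) by exact: linearP.
(* As e vanishes on the triangular ideal, it descends to the quotient. *)
have [eA eAE] : exists e' : {linear A -> A},
    forall x, e' (td_proj T x) = td_proj T (e x).
  apply: linear_factor => // [c x y|x /kerP Jx]; first by rewrite linearP lpr.
  by rewrite (eJ _ _ (tri_gt1V tri) (tri_gt1W tri)) // linear0.
have hAP := grouplike_map_morph mor hP.
have [S SP] : exists S : {linear A -> A}, antipode B S.
  apply: antipode_exists hAP (skew_generated_morph mor surj gen) _.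
  by exists eA => g /=; rewrite eAE eh.
exists double_data; split; first exact: yetter_drinfeld_pairD.
split; first exact: free_braidedD.
exists BD, S'; split; first exact: asymmetric_hopfD.
exists (@td_I _ _ _ _ T), (@td_I' _ _ _ _ T); split.
  exact: (@hopf_ideal_change_pairing _ _ _ pairD (@ad_beta _ _ double_data)).
exists S, (td_proj T); split; [exact: SP | exact: mor | | exact: td_quotient].
exact: antipode_morph mor S' S S'P SP.
Qed.

End NormalForm.

Theorem theorem4 (k : fieldType) (G : groupType) (A : algType k)
    (B : bialgebra A) :
  indecomposable B -> separable_nondegenerate G B ->
  asymmetric_braided_double G B.
Proof.
move=> _ [T0 [T [n [v0 [f0 [v [f [K [L [lam [gam [_ NF _ lam_inj gam0]]]]]]]]]]]].
exact: normal_form_asymmetric NF gam0 lam_inj.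
Qed.
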